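(* Assume (A1)–(A4) and $P^\star\in\Pi_{K^\star}\setminus\Pi_{K^\star-1}$ with $K^\star<\infty$. Suppose $\varphi(u-l)\in L^1(P^\star)$ and that the penalty satisfies, for every $K\ge 1$, $$\liminf_{n\to\infty}\frac{\mathrm{pen}(n,K+1)}{\mathrm{pen}(n,K)}>1\quad\text{and}\quad \limsup_{n\to\infty}\frac{(n\log\log n)^{1/2}}{\mathrm{pen}(n,K)}=0 .$$ (a) If, for every $K\ge1$, $P^\star\notin\Pi_K$ implies $H(P^\star|\Pi_{K+1})<H(P^\star|\Pi_K)$, and if $\mathcal G^a_{K^\star+1}$ is $P^\star$-Donsker, then $P^\star$-a.s. $\widehat K_n^L=K^\star$ for all $n$ large enough. (b) If $K^\star\le K_{\max}$ and $\mathcal G^a_{K_{\max}}$ is $P^\star$-Donsker, then $P^\star$-a.s. $\widehat K_n^G=K^\star$ for all $n$ large enough.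
   Context: Setting: $(\mathcal Z,\mathcal F)$ is a Polish space with its Borel $\sigma$-field and $\mu$ a $\sigma$-finite measure on it. $Z_1,Z_2,\dots$ are i.i.d. $\mathcal Z$-valued random variables with common law $P^\star\ll\mu$, density $p^\star$, $\ell^\star=\log p^\star$; $P^\star$ also denotes the law of the whole sequence. $\{(\Theta_K,d)\}_{K\ge1}$ is an increasing (nested) sequence of metric spaces, $\Theta_\infty=\bigcup_K\Theta_K$; for $\theta\in\Theta_\infty$, $P_\theta$ is a probability measure with density $p_\theta$ w.r.t. $\mu$ and $\ell_\theta=\log p_\theta$. $\Pi_K=\{P_\theta:\theta\in\Theta_K\}$, $\Pi_0=\emptyset$, $\Pi_\infty=\bigcup_K\Pi_K$. The order of $P^\star$ is $K^\star=\min\{K:P^\star\in\Pi_K\}$ ($=\infty$ if $P^\star\notin\Pi_\infty$). $\mathbb P_n=n^{-1}\sum_{i=1}^n\delta_{Z_i}$; $\lambda f=\int f\,d\lambda$. $H(P|Q)=\int\log(dP/dQ)\,dP$ if $P\ll Q$ and $+\infty$ otherwise; $H(P|\Pi)=\inf_{Q\in\Pi}H(P|Q)$, $H(\Pi|Q)=\inf_{P\in\Pi}H(P|Q)$. Given a penalty $\mathrm{pen}(n,K)>0$, $\mathrm{crit}(n,K)=\sup_{\theta\in\Theta_K}\sum_{i=1}^n\ell_\theta(Z_i)-\mathrm{pen}(n,K)$, $\widehat K_n^L=\inf\{K\ge1:\mathrm{crit}(n,K)\ge\mathrm{crit}(n,K+1)\}$, and $\widehat K_n^G$ is the smallest maximizer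 of $K\mapsto\mathrm{crit}(n,K)$ (the maximization being over $1\le K\le K_{\max}$ when a known bound $K_{\max}\ge K^\star$ is assumed). All suprema are assumed measurable. Standing assumptions: (A1) each $(\Theta_K,d)$ is compact and each $\Pi_K$ is compact for the weak topology; (A2) for each $z$ and $K$, $\theta\mapsto\ell_\theta(z)$ is continuous on $\Theta_K$; (A3) there are $l,u:\mathcal Z\to\mathbb R$ with $u-l\in L^1(P^\star)$, $l\le\ell^\star\le u$ and $l\le\ell_\theta\le u$ for all $\theta\in\Theta_\infty$; (A4) for each $n$, $\mathrm{pen}(n,\cdot)$ is increasing, and for each $K$, $\mathrm{pen}(n,K)\to\infty$ and $\mathrm{pen}(n,K)=o(n)$ as $n\to\infty$. Additional notation: $\mathrm{Log}(x)=\log(\max(x,e))$, $\varphi(x)=x^2/\mathrm{Log}\,\mathrm{Log}(x)$; $\mathcal G^a_K=\{\ell_\theta-\ell^\star:\theta\in\Theta_K\}$. ''$P^\star$-Donsker'' is the standard notion for a class of functions (the empirical process indexed by the class converges weakly in $\ell^\infty$ of the class to a tight Gaussian process). *)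

(* Defs.v *)
From HB Require Import structures.
From mathcomp Require Import all_boot all_order all_algebra.
From mathcomp Require Import all_classical all_reals all_analysis.
Set Implicit Arguments. Unset Strict Implicit. Unset Printing Implicit Defensive.
Import Order.TTheory GRing.Theory Num.Theory numFieldNormedType.Exports.
Local Open Scope classical_set_scope.
Local Open Scope ring_scope.

Notation Borel Z := (g_sigma_algebraType (@open Z)).

Definition polish (R : realType) (Z : topologicalType) : Prop :=
  exists d : Z -> Z -> R,
    [/\ (forall x y, 0 <= d x y) /\ (forall x y, d x y = 0 <-> x = y),
        (forall x y, d x y = d y x) /\ (forall x y z, d x z <= d x y + d y z),
        (forall U : set Z, open U <->
           (forall x, U x -> exists2 e, 0 < e & [set y | d x y < e] `<=` U)),
        (forall u : nat -> Z,
           (forall e, 0 < e -> exists N, forall m n, (N <= m)%N -> (N <= n)%N ->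
                d (u m) (u n) < e) ->
           exists x, (fun n => d (u n) x) @ \oo --> 0)
      & exists D : set Z, countable D /\ dense D].

Section Model.
Context (R : realType) (Z : ptopologicalType).
Local Notation ZB := (Borel Z).
Context (mu : {measure set ZB -> \bar R}).

Definition is_density (q : ZB -> R) : Prop :=
  [/\ measurable_fun setT q, (forall z, 0 <= q z) &
      (\int[mu]_z (q z)%:E = 1)%E].

Definition dmeas (q : ZB -> R) (A : set ZB) : \bar R :=
  (\int[mu]_(z in A) (q z)%:E)%E.

Definition same_law (q1 q2 : ZB -> R) : Prop :=
  forall A, measurable A -> dmeas q1 A = dmeas q2 A.

Definition L1_dens (q : ZB -> R) (f : ZB -> R) : Prop :=
  mu.-integrable setT (fun z => (f z * q z)%:E).

Definition Edens (q : ZB -> R) (f : ZB -> R) : R :=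
  fine (\int[mu]_z (f z * q z)%:E)%E.

Definition bcont (f : Z -> R) : Prop :=
  continuous f /\ exists M, forall z, `|f z| <= M.

(** open sets for the weak topology (of probability measures, represented by
    their densities): generated by the maps P |-> P f, f bounded continuous *)
Definition weak_open (U : set (Z -> R)) : Prop :=
  forall q, U q -> exists (k : nat) (fs : nat -> Z -> R) (e : R),
    [/\ 0 < e, (forall i, (i < k)%N -> bcont (fs i)) &
       [set q' | forall i, (i < k)%N -> `|Edens q' (fs i) - Edens q (fs i)| < e]
         `<=` U].

Definition weak_compact (A : set (Z -> R)) : Prop :=
  forall (I : Type) (U : I -> set (Z -> R)), (forall i, weak_open (U i)) ->
    A `<=` \bigcup_i U i ->
    exists (k : nat) (j : nat -> I), A `<=` \bigcup_(m in [set m : nat | (m < k)%N]) U (j m).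

(** Kullback-Leibler divergence H(P|Q) for P, Q with densities p, q w.r.t. mu:
    P << Q iff mu(p > 0, q = 0) = 0, and then dP/dQ = p/q P-a.s. *)
Definition KL (p q : ZB -> R) : \bar R :=
  if mu [set z | (0 < p z)%R /\ (q z <= 0)%R] == 0%E
  then (\int[mu]_(z in [set z | (0 < p z)%R]) (p z * ln (p z / q z))%:E)%E
  else +oo%E.

Definition KLset (p : ZB -> R) (Pi : set (Z -> R)) : \bar R :=
  ereal_inf [set KL p q | q in Pi].

Definition cylinders : set (set (nat -> Z)) :=
  [set C | exists (k : nat) (A : nat -> set ZB), (forall i, measurable (A i)) /\
       C = [set w | forall i, (i < k)%N -> A i (w i)]].

Definition Seq := g_sigma_algebraType cylinders.

Definition iid_law (pstar : ZB -> R) (P : probability Seq R) : Prop :=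
  forall (k : nat) (A : nat -> set ZB), (forall i, measurable (A i)) ->
    P [set w : Seq | forall i, (i < k)%N -> A i (w i)] =
    (\prod_(i < k) fine (dmeas pstar (A i)))%:E.

Section Donsker.
Variable F : set (Z -> R).

Definition linf (x : (Z -> R) -> R) : Prop :=
  exists M, forall f, F f -> `|x f| <= M.

Definition supdist (x y : (Z -> R) -> R) : R :=
  sup [set `|x f - y f| | f in F].

Definition linf_open (U : set ((Z -> R) -> R)) : Prop :=
  U `<=` linf /\ forall x, U x -> exists2 e, 0 < e &
     forall y, linf y -> supdist x y < e -> U y.

Definition linf_compact (K : set ((Z -> R) -> R)) : Prop :=
  K `<=` linf /\
  forall (I : Type) (U : I -> set ((Z -> R) -> R)), (forall i, linf_open (U i)) ->
    K `<=` \bigcup_i U i ->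
    exists (k : nat) (j : nat -> I), K `<=` \bigcup_(m in [set m : nat | (m < k)%N]) U (j m).

Definition linf_bcont (h : ((Z -> R) -> R) -> R) : Prop :=
  (exists M, forall x, linf x -> `|h x| <= M) /\
  forall x, linf x -> forall e, 0 < e -> exists2 d, 0 < d &
     forall y, linf y -> supdist x y < d -> `|h y - h x| < e.

Definition outer_E (P : probability Seq R) (Y : Seq -> R) : \bar R :=
  ereal_inf [set (\int[P]_w (U w)%:E)%E | U in
     [set U : Seq -> R | [/\ measurable_fun setT U,
         P.-integrable setT (EFin \o U) & forall w, Y w <= U w]]].

Definition normal_rv d' (O : measurableType d') (P' : probability O R)
  (Y : O -> R) : Prop :=
  measurable_fun setT Y /\ exists m s : R,
    (s = 0 /\ P' (Y @^-1` [set m]) = 1%E) \/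
    (0 < s /\ forall A : set R, measurable A -> P' (Y @^-1` A) = normal_prob m s A).

Definition emp_proc (pstar : ZB -> R) (n : nat) (w : Seq) (f : Z -> R) : R :=
  Num.sqrt n%:R * (n%:R^-1 * \sum_(i < n) f (w i) - Edens pstar f).

(** F is P-Donsker (P has density pstar, P^N = Pinf): the empirical process
    converges weakly in l^infty(F) (Hoffmann-Jorgensen sense) to a tight
    Borel measurable Gaussian process. *)
Definition donsker (pstar : ZB -> R) (Pinf : probability Seq R) : Prop :=
  (forall n w, linf (emp_proc pstar n w)) /\
  exists (d' : measure_display) (O : measurableType d') (P' : probability O R)
         (G : O -> (Z -> R) -> R),
    [/\ forall o, linf (G o),
        forall U, linf_open U -> measurable (G @^-1` U),
        forall e, 0 < e -> exists K, linf_compact K /\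
                 (1 - e <= fine (P' (G @^-1` K)))%R,
        forall (k : nat) (fs : nat -> Z -> R) (a : nat -> R),
          (forall i, (i < k)%N -> F (fs i)) ->
          normal_rv P' (fun o => \sum_(i < k) a i * G o (fs i))
      & forall h, linf_bcont h ->
          (fun n => outer_E Pinf (fun w => h (emp_proc pstar n w)))
            @ \oo --> (\int[P']_o (h (G o))%:E)%E].
End Donsker.
End Model.

Definition Logm (R : realType) (x : R) : R := ln (Num.max x (expR 1)).
Definition phiLL (R : realType) (x : R) : R := x ^+ 2 / Logm (Logm x).

Definition crit (R : realType) (Z : Type) (Theta : Type) (ThetaK : nat -> set Theta)
  (p : Theta -> Z -> R) (pen : nat -> nat -> R) (w : nat -> Z) (n K : nat) : \bar R :=
  (ereal_sup [set (\sum_(i < n) ln (p th (w i)))%:E | th in ThetaK K]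
     - (pen n K)%:E)%E.

Definition is_KhatL (R : realType) (c : nat -> \bar R) (K : nat) : Prop :=
  [/\ (1 <= K)%N, (c K.+1 <= c K)%E &
      forall k, (1 <= k < K)%N -> (c k < c k.+1)%E].

Definition is_KhatG (R : realType) (c : nat -> \bar R) (Kmax K : nat) : Prop :=
  [/\ (1 <= K <= Kmax)%N, (forall k, (1 <= k <= Kmax)%N -> (c k <= c K)%E) &
      forall k, (1 <= k < K)%N -> (c k < c K)%E].

(* Main.v *)
(** Everything reduces to a bounded law of the iterated logarithm: almost surely,
    sup over theta in Theta_K of |sum_(i < n) (l_theta - l_star)(Z_i) - n E(theta)|
    is O(sqrt (n log log n)), where E(theta) = P_star (l_theta - l_star) is minus a
    Kullback-Leibler divergence.  Since pen dominates sqrt (n log log n), the linear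
    gaps of n E rule out underestimation and the penalty gaps rule out
    overestimation.

    The law of the iterated logarithm only uses that the Donsker property makes
    the sup-norm of S_n / sqrt n bounded in probability.  On the dyadic block n = 2^k
    put b = sqrt (n log k), v = min 1 (F / b) and G_k = n E v^4; the moment
    condition on the envelope F says that the G_k are summable.  Choose an integer
    kappa <= log k with kappa^6 G_k <= 1 and cut the block into kappa pieces.
    Each piece has fluctuations of order sqrt (n / kappa) <= b / kappa, so a walk with
    steps truncated at b / kappa exceeds C b only if it makes about kappa
    independent excursions of small probability, which costs an exponential in
    kappa; and the few steps larger than b / kappa have a sum of order b off an
    event of probability at most 2 G_k.  With kappa as large as allowed, these
    probabilities are bounded by k^(-2) + 3 G_k, and Borel-Cantelli applies. *)
Require Import Defs.
From HB Require Import structures.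
From mathcomp Require Import all_boot all_order all_algebra.
From mathcomp Require Import all_classical all_reals all_analysis.
From mathcomp Require Import measurable_realfun.
From mathcomp Require Import ring lra zify.
Set Implicit Arguments. Unset Strict Implicit. Unset Printing Implicit Defensive.
Import Order.TTheory GRing.Theory Num.Theory numFieldNormedType.Exports.
Local Open Scope classical_set_scope.
Local Open Scope ring_scope.

(** * Coordinates, shifts and cut-and-paste maps on sequence space *)

Section Splicing.
Context (Z : ptopologicalType).
Local Notation ZB := (Borel Z).

Definition shift (s : nat) (w : Seq Z) : Seq Z := fun i => w (s + i)%N.

Definition splice (s : nat) (x : Seq Z * Seq Z) : Seq Z :=
  fun i => if (i < s)%N then x.1 i else x.2 (i - s)%N.

Definition cyl (k : nat) (A : nat -> set ZB) : set (Seq Z) :=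
  [set w | forall i, (i < k)%N -> A i (w i)].

Lemma cyl_measurable k A : (forall i, measurable (A i)) -> measurable (cyl k A).
Proof. by move=> mA; apply: sub_sigma_algebra; exists k, A. Qed.

(** Padding with full factors makes every cylinder longer than a given cut time [s], so that
    [splice_cyl] applies to it. *)
Lemma cyl_extend s k A : cyl k A = cyl (s + k) (fun i => if (i < k)%N then A i else setT).
Proof.
apply/seteqP; split => w /= H i.
  by move=> _; case: ifPn => // ik; exact: H.
by move=> ik; have := H i; rewrite ik; apply; rewrite ltn_addl.
Qed.

(** A spliced sequence reads its first [s] coordinates from one copy and the others from the second
    copy, so cylinders pull back to rectangles, whose product measure is computable. *)
Lemma splice_cyl s k A :
  splice s @^-1` (cyl (s + k) A) = cyl s A `*` cyl k (fun i => A (s + i)%N).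
Proof.
apply/seteqP; split => -[w w'] /=; rewrite /cyl /splice /=.
  move=> H; split => i ik.
    by have := H i; rewrite ik; apply; rewrite ltn_addr.
  have := H (s + i)%N; rewrite ltn_add2l => /(_ ik).
  by rewrite ifN ?addKn// -leqNgt leq_addr.
move=> [H1 H2] i isk; case: ifPn => [/H1//|]; rewrite -leqNgt => si.
by have := H2 (i - s)%N; rewrite subnKC//; apply; rewrite ltn_subLR.
Qed.

Lemma measurable_splice s : measurable_fun setT (splice s).
Proof.
apply: (@measurability _ _ _ (Seq Z) setT (splice s) (@cylinders Z)) => // _ [_ [k [A [mA ->]]] <-].
rewrite setTI -/(cyl k A) (cyl_extend s) splice_cyl.
by apply: measurableX; apply: cyl_measurable => i /=; case: ifP.
Qed.

Lemma measurable_shift s : measurable_fun setT (shift s).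
Proof.
apply: (@measurability _ _ _ (Seq Z) setT (shift s) (@cylinders Z)) => // _ [_ [k [A [mA ->]]] <-].
rewrite setTI.
rewrite [X in measurable X](_ : _ =
  cyl (s + k) (fun i => if (i < s)%N then setT else A (i - s)%N)).
  by apply: cyl_measurable => i; case: ifP.
apply/seteqP; split => w /=; rewrite /cyl /shift /= => H i.
  move=> isk; case: ifPn => //; rewrite -leqNgt => si.
  by have := H (i - s)%N; rewrite subnKC//; apply; rewrite ltn_subLR.
move=> ik; have := H (s + i)%N; rewrite ltn_add2l addKn => /(_ ik).
by rewrite ifN// -leqNgt leq_addr.
Qed.

Lemma measurable_coord i : measurable_fun setT (fun w : Seq Z => w i : ZB).
Proof.
move=> _ A mA; rewrite setTI.
rewrite [X in measurable X](_ : _ = cyl i.+1 (fun j => if j == i then A else setT)).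
  by apply: cyl_measurable => j; case: ifP.
apply/seteqP; split => w /=; rewrite /cyl /=.
  by move=> H j _; case: eqP => // ->.
by move=> /(_ i); rewrite ltnS leqnn eqxx; exact.
Qed.

Lemma cylinders_setI_closed : setI_closed (@cylinders Z).
Proof.
move=> _ _ [k [A [mA ->]]] [h [B [mB ->]]].
exists (maxn k h), (fun i => (if (i < k)%N then A i else setT) `&`
                             (if (i < h)%N then B i else setT)); split.
  by move=> i; apply: measurableI; case: ifP.
apply/seteqP; split => w /=.
  by move=> [HA HB] i _; split; case: ifP => // /[dup] ? ; [move/HA|move/HB].
move=> H; split => i ik; have := H i.
  by rewrite leq_max ik /= => /(_ isT) [].
by rewrite leq_max ik orbT /= => /(_ isT) [_].
Qed.

End Splicing.

(** * Independence and stationarity under the i.i.d. law *)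

Section Independence.
Context (R : realType) (Z : ptopologicalType).
Local Notation ZB := (Borel Z).
Context (mu : {measure set ZB -> \bar R}) (pstar : ZB -> R) (P : probability (Seq Z) R).
Hypothesis iidP : iid_law mu pstar P.

(* Cutting a sequence at time s into two independent pieces and gluing an
   independent copy of the second piece leaves the i.i.d. law unchanged. *)
Lemma splice_law s (A : set (Seq Z)) : measurable A ->
  P A = (P \x P)%E (splice s @^-1` A).
Proof.
move=> mA.
have ms : measurable_fun setT (@splice Z s) by exact: measurable_splice.
transitivity (pushforward (P \x P)%E (@splice Z s) A); last by [].
pose m2 : {measure set (Seq Z) -> \bar R} := pushforward (P \x P)%E (@splice Z s).
(* Two finite measures that agree on the cylinders, a generating family closed under intersection,
   are equal. *)
apply: (@measure_unique _ R (Seq Z) (@cylinders Z) (fun _ => setT) _ _ _ _ P (m2 ms)) => //.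
- exact: cylinders_setI_closed.
- by move=> _; exists 0%N, (fun=> setT); split => //; apply/seteqP; split.
- by rewrite bigcup_const//; exists 0%N.
- move=> _ [k [A' [mA' ->]]]; rewrite /m2 /=.
  rewrite -/(cyl k A') (cyl_extend s) /pushforward splice_cyl.
  set B := fun i => if (i < k)%N then _ else _.
  have mB i : measurable (B i) by rewrite /B; case: ifP.
  rewrite product_measure1E; [|by apply: cyl_measurable => i; exact: mB..].
  have PB1 := iidP s mB.
  have PB2 := iidP k (fun i => mB (s + i)%N).
  rewrite /cyl (iidP (s + k) mB) [X in (X * _)%E]PB1 [X in (_ * X)%E]PB2 -EFinM.
  congr (_%:E).
  by rewrite big_split_ord /=.
- by move=> _; rewrite (le_lt_trans (probability_le1 _ _))// ltry.
Qed.

(** Pulled back along [splice s], the event [A] depends on the first copy only and the shifted event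
    is [B] for the second copy, so the intersection becomes a rectangle. *)
Lemma shift_indep s (A B : set (Seq Z)) : measurable A -> measurable B ->
  (forall w w' : Seq Z, (forall i, (i < s)%N -> w i = w' i) -> A w -> A w') ->
  P (A `&` shift s @^-1` B) = (P A * P B)%E.
Proof.
move=> mA mB Aloc.
have mS : measurable (shift s @^-1` B : set (Seq Z)).
  by rewrite -[X in measurable X]setTI; exact: measurable_shift.
rewrite (splice_law s); last exact: measurableI.
rewrite (_ : _ @^-1` _ = A `*` B); first by rewrite product_measure1E.
apply/seteqP; split => -[w w'] /= [Aw Bw]; split.
- by apply: Aloc Aw => i si; rewrite /splice si.
- move: Bw; rewrite /shift /splice /=.
  rewrite (_ : (fun i => _) = w')//; apply/funext => i.
  by rewrite ifN ?addKn// -leqNgt leq_addr.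
- by apply: Aloc Aw => i si; rewrite /splice si.
- rewrite /shift /splice /=.
  rewrite (_ : (fun i => _) = w')//; apply/funext => i.
  by rewrite ifN ?addKn// -leqNgt leq_addr.
Qed.

Lemma shift_stationary s (B : set (Seq Z)) : measurable B ->
  P (shift s @^-1` B) = P B.
Proof.
move=> mB; have := @shift_indep s setT B measurableT mB (fun _ _ _ _ => I).
by rewrite setTI probability_setT mul1e.
Qed.

End Independence.

(** * Maximal inequalities for partial sums over a countable class *)

Section MaximalInequalities.
Context (R : realType) (Z : ptopologicalType).
Local Notation ZB := (Borel Z).
Context (mu : {measure set ZB -> \bar R}) (pstar : ZB -> R) (P : probability (Seq Z) R).
Hypothesis iidP : iid_law mu pstar P.

Definition Pr (A : set (Seq Z)) : R := fine (P A).

Lemma PrE (A : set (Seq Z)) : measurable A -> P A = (Pr A)%:E.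
Proof. by move=> mA; rewrite /Pr fineK// fin_num_measure. Qed.

Lemma Pr_ge0 (A : set (Seq Z)) : 0 <= Pr A.
Proof. by rewrite /Pr fine_ge0. Qed.

Lemma Pr_le1 (A : set (Seq Z)) : measurable A -> Pr A <= 1.
Proof. by move=> mA; rewrite -lee_fin -PrE// probability_le1. Qed.

Lemma le_Pr (A B : set (Seq Z)) : measurable A -> measurable B -> A `<=` B ->
  Pr A <= Pr B.
Proof. by move=> mA mB AB; rewrite -lee_fin -!PrE// le_measure ?inE. Qed.

Lemma PrU (A B : set (Seq Z)) : measurable A -> measurable B ->
  Pr (A `|` B) <= Pr A + Pr B.
Proof.
move=> mA mB; rewrite -lee_fin EFinD -!PrE//; last exact: measurableU.
exact: measureU2.
Qed.

Lemma Pr_shift s (B : set (Seq Z)) : measurable B -> Pr (shift s @^-1` B) = Pr B.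
Proof. by move=> mB; rewrite /Pr (shift_stationary iidP). Qed.

Lemma measurable_shift_preimage s (B : set (Seq Z)) : measurable B ->
  measurable (shift s @^-1` B : set (Seq Z)).
Proof. by move=> mB; rewrite -[X in measurable X]setTI; exact: measurable_shift. Qed.

Definition psum (g : nat -> Z -> R) (i j : nat) (w : Seq Z) : R :=
  \sum_(l < i) g j (w l).

(** The existential over [j] says that the sup norm over the class exceeds [a]; as a countable union
    it is measurable, and no possibly infinite supremum has to be formed. *)
Definition exc (g : nat -> Z -> R) (i : nat) (a : R) : set (Seq Z) :=
  [set w | exists j, a < `|psum g i j w|].

Definition maxexc (g : nat -> Z -> R) (N : nat) (a : R) : set (Seq Z) :=
  [set w | exists2 i, (i <= N)%N & exc g i a w].

Lemma psumD g s i j w : psum g (s + i) j w = psum g s j w + psum g i j (shift s w).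
Proof. by rewrite /psum big_split_ord. Qed.

Lemma psumS g i j w : psum g i.+1 j w = psum g i j w + g j (w i).
Proof. by rewrite /psum big_ord_recr. Qed.

Lemma psum0 g j w : psum g 0 j w = 0.
Proof. by rewrite /psum big_ord0. Qed.

Lemma exc_local g i a (w w' : Seq Z) : (forall l, (l < i)%N -> w l = w' l) ->
  exc g i a w -> exc g i a w'.
Proof.
move=> ww' [j]; exists j; rewrite /psum.
by under eq_bigr do rewrite -ww'//.
Qed.

Section Class.
Variable g : nat -> Z -> R.
Hypothesis mg : forall j, measurable_fun setT (g j : ZB -> R).

Lemma measurable_psum i j : measurable_fun setT (psum g i j).
Proof.
rewrite /psum; apply: measurable_sum => l.
exact: (measurableT_comp (mg j) (measurable_coord l)).
Qed.

Lemma measurable_exc i a : measurable (exc g i a).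
Proof.
rewrite (_ : exc g i a = \bigcup_j [set w | a < `|psum g i j w|]); last first.
  by apply/seteqP; split => w [j]; [exists j|move=> _; exists j].
apply: bigcup_measurable => j _; rewrite -[X in measurable X]setTI.
rewrite (_ : [set w | _] = (fun w => `|psum g i j w|) @^-1` `]a, +oo[); last first.
  by apply/seteqP; split => w /=; rewrite in_itv /= andbT.
by apply: measurableT_comp => //; exact: measurable_psum.
Qed.

Lemma maxexcE N a : maxexc g N a = \big[setU/set0]_(s < N.+1) exc g s a.
Proof.
rewrite -(bigcup_mkord N.+1 (fun s => exc g s a)); apply/seteqP; split => w.
  by move=> [i iN ei]; exists i.
by move=> [i /= iN ei]; exists i.
Qed.

Lemma measurable_maxexc N a : measurable (maxexc g N a).
Proof. by rewrite maxexcE; apply: bigsetU_measurable => i _; exact: measurable_exc. Qed.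

Lemma maxexc0 a : 0 <= a -> maxexc g 0 a = set0.
Proof.
move=> a0; apply/seteqP; split => // w [i]; rewrite leqn0 => /eqP -> [j].
by rewrite psum0 normr0 ltNge a0.
Qed.

Lemma Pr_maxexc0 a : 0 <= a -> Pr (maxexc g 0 a) = 0.
Proof. by move=> a0; rewrite maxexc0// /Pr measure0. Qed.

Lemma maxexcS N a a' : a' <= a -> maxexc g N a `<=` maxexc g N a'.
Proof. by move=> aa' w [i iN [j H]]; exists i => //; exists j; exact: le_lt_trans H. Qed.

(** The disjointification of the exceedance events is the first-passage decomposition: [s] is the
    first time at which the level [a] is exceeded. *)
Definition fpass (a : R) (s : nat) : set (Seq Z) := seqDU (fun s => exc g s a) s.

Lemma measurable_fpass a s : measurable (fpass a s).
Proof. by apply: seqDU_measurable => i; exact: measurable_exc. Qed.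

Lemma fpassP a s w : fpass a s w <->
  exc g s a w /\ (forall i, (i < s)%N -> ~ exc g i a w).
Proof.
rewrite /fpass /seqDU -(bigcup_mkord s (fun s => exc g s a)); split => [[es H]|[es H]]; split => //.
  by move=> i si ei; apply: H; exists i.
by move=> [i /= si ei]; exact: (H i).
Qed.

Lemma maxexc_fpass a m w : maxexc g m a w -> exists2 s, (s <= m)%N & fpass a s w.
Proof.
rewrite maxexcE (bigsetU_seqDU (fun s => exc g s a)) -(bigcup_mkord m.+1 (fpass a)).
by move=> [s /= sm H]; exists s.
Qed.

Lemma sum_fpass a m : (\sum_(s < m.+1) P (fpass a s) = P (maxexc g m a))%E.
Proof.
rewrite maxexcE (bigsetU_seqDU (fun s => exc g s a)).
rewrite measure_semi_additive_ord_I//.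
- by move=> k _; exact: measurable_fpass.
- exact: (sub_trivIset (@subsetT _ _) (@trivIset_seqDU _ _)).
- by apply: bigsetU_measurable => i _; exact: measurable_fpass.
Qed.

Lemma fpass_local a s (w w' : Seq Z) : (forall l, (l < s)%N -> w l = w' l) ->
  fpass a s w -> fpass a s w'.
Proof.
move=> ww' /fpassP[es H]; apply/fpassP; split; first exact: exc_local es.
move=> i si; apply: contra_not (H i si); apply: exc_local => l li.
by rewrite ww'// (ltn_trans li).
Qed.

(** Split at the first passage above [a]. If it occurs by time [m], the walk has overshot by at most
    one step [c], so a fresh independent excursion above [y] must follow. Otherwise the walk is
    still below [a] at time [m], and the excursion above [y] must fit into the remaining [N - m]
    steps. *)
Lemma maxexc_recurrence (c a y : R) m N : (m <= N)%N -> 0 <= a -> 0 <= y ->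
  (forall j z, `|g j z| <= c) ->
  Pr (maxexc g N (a + c + y)) <=
    Pr (maxexc g m a) * Pr (maxexc g N y) + Pr (maxexc g (N - m) y).
Proof.
move=> mN a0 y0 gc.
have c0 : 0 <= c by exact: le_trans (gc 0%N point).
pose A s := fpass a s `&` shift s @^-1` (maxexc g N y).
have mA s : measurable (A s).
  apply: measurableI; first exact: measurable_fpass.
  by apply: measurable_shift_preimage; exact: measurable_maxexc.
have sub : maxexc g N (a + c + y) `<=`
    \big[setU/set0]_(s < m.+1) A s `|` shift m @^-1` (maxexc g (N - m) y).
  move=> w [i iN [j ij]].
  have [/maxexc_fpass[s sm fs]|nm] := pselect (maxexc g m a w).
    left; rewrite -bigcup_mkord; exists s => //; split => //.
    move/fpassP : fs => [es fs].
    have [si|si] := leqP s i; last first.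
      exfalso; apply: (fs i si); exists j.
      by apply: le_lt_trans ij; rewrite -addrA lerDl addr_ge0.
    (* One step before the first passage the norm is still at most [a]. *)
    have Ss : `|psum g s j w| <= a + c.
      case: s {sm es si} fs => [|s] fs; first by rewrite psum0 normr0 addr_ge0.
      rewrite psumS (le_trans (ler_normD _ _))// lerD//.
      by rewrite leNgt; apply/negP => H; apply: (fs s (ltnSn s)); exists j.
    exists (i - s)%N; first by rewrite leq_subLR (leq_trans iN)// leq_addl.
    exists j; rewrite -(ltrD2l (a + c)) (lt_le_trans ij)//.
    by rewrite -{1}(subnKC si) psumD (le_trans (ler_normD _ _))// lerD2r.
  right; have [im|mi] := leqP i m.
    exfalso; apply: nm; exists i => //; exists j.
    by apply: le_lt_trans ij; rewrite -addrA lerDl addr_ge0.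
  exists (i - m)%N; first by rewrite leq_sub2r.
  exists j; rewrite -(ltrD2l (a + c)) (lt_le_trans ij)//.
  rewrite -{1}(subnKC (ltnW mi)) psumD (le_trans (ler_normD _ _))// lerD2r.
  rewrite (@le_trans _ _ a) ?lerDl// leNgt; apply/negP => H.
  by apply: nm; exists m => //; exists j.
have mU : measurable (\big[setU/set0]_(s < m.+1) A s).
  by apply: bigsetU_measurable => s _; exact: mA.
have mS := measurable_shift_preimage m (measurable_maxexc (N - m) y).
apply: (le_trans (le_Pr (measurable_maxexc _ _) (measurableU _ _ mU mS) sub)).
apply: (le_trans (PrU mU mS)); rewrite Pr_shift ?lerD2r; last exact: measurable_maxexc.
rewrite -lee_fin EFinM -!PrE; [|exact: measurable_maxexc..|exact: mU].
apply: (le_trans (Boole_inequality P _)); first by move=> i _; exact: mA.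
rewrite -sum_fpass ge0_sume_distrl; last by move=> i _; exact: measure_ge0.
apply: lee_sum => s _.
have HA : P (A s) = (P (fpass a s) * P (maxexc g N y))%E.
  apply: (shift_indep iidP); [exact: measurable_fpass|exact: measurable_maxexc|].
  by move=> w w' ww'; exact: fpass_local.
by rewrite [leLHS]HA.
Qed.

(** Iterates [maxexc_recurrence]: each unit of [q] either costs a factor [theta] or uses up one of
    the [k] blocks of length [m]. *)
Lemma maxexc_tail (c a theta : R) m k q : 0 <= a -> 0 < theta -> theta <= 1 ->
  (forall j z, `|g j z| <= c) -> Pr (maxexc g m a) <= theta ->
  Pr (maxexc g (k * m) (q%:R * (a + c))) <= theta^-1 ^+ k * (2 * theta) ^+ q.
Proof.
move=> a0 th0 th1 gc Hm.
have c0 : 0 <= c by exact: le_trans (gc 0%N point).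
elim: q k => [|q IH] k.
  rewrite expr0 mulr1 (le_trans (Pr_le1 (measurable_maxexc _ _)))//.
  by rewrite exprn_ege1// invf_ge1.
have y0 : 0 <= q%:R * (a + c) by rewrite mulr_ge0// addr_ge0.
case: k => [|k].
  rewrite mul0n Pr_maxexc0; last by rewrite mulr_ge0// addr_ge0.
  by rewrite mulr_ge0 ?exprn_ge0 ?invr_ge0 ?mulr_ge0// ltW.
rewrite -natr1 mulrDl mul1r addrC.
apply: (le_trans (@maxexc_recurrence c a _ m _ _ a0 y0 gc)).
  by rewrite mulSn leq_addr.
rewrite (_ : (k.+1 * m - m = k * m)%N); last by rewrite mulSn addKn.
(* The claimed bound is twice [theta^-1 ^+ k * (2 * theta) ^+ q], and each of the two terms of the
   recurrence accounts for one half. *)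
have -> : theta^-1 ^+ k.+1 * (2 * theta) ^+ q.+1 =
    theta * (theta^-1 ^+ k.+1 * (2 * theta) ^+ q) + theta^-1 ^+ k * (2 * theta) ^+ q.
  by rewrite !exprS; field; rewrite gt_eqF.
apply: lerD; last exact: IH.
by apply: ler_pM => //; exact: Pr_ge0.
Qed.

(** Ottaviani's inequality: after a first passage above [t + t] at time [s], the independent
    increment up to [m] is at most [t] with probability at least [1 - d], and then the norm at time
    [m] exceeds [t]. *)
Lemma ottaviani (t d : R) m : 0 <= t ->
  (forall i, (i <= m)%N -> Pr (exc g i t) <= d) ->
  Pr (maxexc g m (t + t)) * (1 - d) <= d.
Proof.
move=> t0 Hd.
pose A s := fpass (t + t) s `&` shift s @^-1` (~` exc g (m - s) t).
have mA s : measurable (A s).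
  apply: measurableI; first exact: measurable_fpass.
  by apply: measurable_shift_preimage; apply: measurableC; exact: measurable_exc.
have sub : \big[setU/set0]_(s < m.+1) A s `<=` exc g m t.
  move=> w; rewrite -bigcup_mkord => -[s /= sm [/fpassP[[j Hj] _] Hs]].
  exists j; rewrite ltNge; apply/negP => H.
  move: Hj; rewrite ltNge => /negP; apply.
  rewrite -[psum g s j w](addrK (psum g (m - s) j (shift s w))) -psumD subnKC//.
  rewrite (le_trans (ler_normB _ _))// lerD// leNgt; apply/negP => H'.
  by apply: Hs; exists j.
apply: le_trans (Hd m (leqnn m)).
rewrite -lee_fin EFinM -!PrE; [|exact: measurable_exc|exact: measurable_maxexc].
apply: le_trans (le_measure _ _ _ sub); last 2 first.
  by rewrite inE; apply: bigsetU_measurable.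
  by rewrite inE; exact: measurable_exc.
rewrite measure_semi_additive_ord_I//; last 2 first.
- apply/trivIsetP => i j _ _ ij.
  have /trivIsetP/(_ i j I I ij) := trivIset_seqDU (fun s => exc g s (t + t)).
  move=> H; rewrite /A setIACA [X in X `&` _](_ : _ = set0) ?set0I//.
- by apply: bigsetU_measurable => i _; exact: mA.
rewrite -sum_fpass ge0_sume_distrl; last by move=> i _; exact: measure_ge0.
apply: lee_sum => s _.
have HA : P (A s) = (P (fpass (t + t) s) * P (~` exc g (m - s) t))%E.
  apply: (shift_indep iidP); first exact: measurable_fpass.
    by apply: measurableC; exact: measurable_exc.
  by move=> w w' ww'; exact: fpass_local.
rewrite [leRHS]HA; apply: lee_wpmul2l => //.
rewrite probability_setC; last exact: measurable_exc.
rewrite PrE; last exact: measurable_exc.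
by rewrite -EFinB lee_fin lerB// Hd// leq_subr.
Qed.

(** Handles times below [n0], where tightness gives nothing: a sum of length [i] is a sum of length
    [i + n0] minus the following sum of length [n0], and both are long enough. *)
Lemma exc_short (M d : R) n0 : 0 <= M ->
  (forall n, (n0 <= n)%N -> Pr (exc g n (M * Num.sqrt n%:R)) <= d) ->
  forall m i, (i <= m)%N ->
  Pr (exc g i (2 * M * Num.sqrt (m + n0)%:R)) <= 2 * d.
Proof.
move=> M0 Hd m i im.
have mS := measurable_shift_preimage i (measurable_exc n0 (M * Num.sqrt n0%:R)).
have mE := measurable_exc (i + n0) (M * Num.sqrt (i + n0)%:R).
have sub : exc g i (2 * M * Num.sqrt (m + n0)%:R) `<=`
    exc g (i + n0) (M * Num.sqrt (i + n0)%:R) `|`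
    shift i @^-1` exc g n0 (M * Num.sqrt n0%:R).
  move=> w [j Hj].
  apply: contrapT => /not_orP[H1 H2]; move: Hj; rewrite ltNge => /negP; apply.
  rewrite -[psum g i j w](addrK (psum g n0 j (shift i w))) -psumD.
  rewrite (le_trans (ler_normB _ _))// -mulrA mulr2n mulrDl mul1r lerD//.
    rewrite leNgt; apply/negP => H; apply: H1; exists j.
    apply: le_lt_trans H; rewrite ler_wpM2l// ler_sqrt ?ler_nat ?leq_add2r//.
  rewrite leNgt; apply/negP => H; apply: H2; exists j.
  by apply: le_lt_trans H; rewrite ler_wpM2l// ler_sqrt ?ler_nat ?leq_addl.
apply: (le_trans (le_Pr (measurable_exc _ _) (measurableU _ _ mE mS) sub)).
apply: (le_trans (PrU mE mS)); rewrite Pr_shift; last exact: measurable_exc.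
by rewrite mulr2n mulrDl mul1r lerD// Hd// leq_addl.
Qed.

End Class.
End MaximalInequalities.

(** * Deterministic estimates on dyadic scales *)

Section DyadicScales.
Variable R : realType.
Implicit Types (x y : R) (k n : nat).

(** Integer stand-in for the iterated logarithm of [2 ^ k]. The successor keeps it positive and
    gives [k < 2 ^ LLn k]. *)
Definition LLn (k : nat) : nat := (trunc_log 2 k).+1.

Definition bscale (k : nat) : R := Num.sqrt ((2 ^ k * LLn k)%N%:R).

Definition vcut (k : nat) (x : R) : R := Num.min 1 (x / bscale k).

Lemma ltn_exp2_LLn k : (k < 2 ^ LLn k)%N.
Proof. exact: trunc_log_ltn. Qed.

Lemma LLn_leq k : (0 < k)%N -> (LLn k <= k)%N.
Proof.
move=> k0; have := trunc_logP (ltnSn 1) k0.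
by apply: leq_trans; exact: ltn_expl.
Qed.

Lemma leq_sqr_exp2 k : (4 <= k)%N -> (k * k <= 2 ^ k)%N.
Proof.
elim: k => // k IH; rewrite leq_eqVlt => /predU1P[<-//|k4].
have {}IH := IH k4; rewrite expnS; nia.
Qed.

Lemma bscale_sqr k : bscale k ^+ 2 = (2 ^ k * LLn k)%N%:R.
Proof. by rewrite sqr_sqrtr. Qed.

Lemma bscale_gt0 k : 0 < bscale k.
Proof. by rewrite sqrtr_gt0 ltr0n muln_gt0 expn_gt0. Qed.

Lemma vcut_ge0 k x : 0 <= x -> 0 <= vcut k x.
Proof. by move=> x0; rewrite le_min ler01 divr_ge0// ltW// bscale_gt0. Qed.

Lemma vcut_le1 k x : vcut k x <= 1.
Proof. by rewrite ge_min lexx. Qed.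

Definition LLx x : R := Logm (Logm x).

Lemma Logm_ge1 x : 1 <= Logm x.
Proof.
rewrite /Logm -{1}(expRK 1) ler_ln ?posrE ?expR_gt0 ?lt_max ?expR_gt0 ?orbT//.
by rewrite le_max lexx orbT.
Qed.

Lemma Logm_le x : Logm x <= Num.max 1 x.
Proof.
rewrite /Logm; case: (leP x (expR 1)) => xe; first by rewrite expRK le_max lexx.
by rewrite le_max (ltW (ln_sublinear _)) ?orbT// (lt_trans _ xe)// expR_gt0.
Qed.

Lemma LLx_ge1 x : 1 <= LLx x.
Proof. exact: Logm_ge1. Qed.

Lemma LLx_le x : 1 <= x -> LLx x <= x.
Proof.
move=> x1; apply: (le_trans (Logm_le _)); rewrite ge_max x1 /=.
by apply: (le_trans (Logm_le _)); rewrite ge_max x1 lexx.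
Qed.

(** From [1 + x <= expR x] at [x = - 1 / 2]. The numerical bounds on [expR 1] and [ln 2] follow from
    it. *)
Lemma expRhalf_le2 : expR (1 / 2) <= 2 :> R.
Proof.
have := @expR_ge1Dx R (- (1 / 2)); rewrite expRN => H.
have e0 : 0 < expR (1 / 2) :> R by exact: expR_gt0.
rewrite -[leLHS]invrK -[leRHS]invrK lef_pV2 ?posrE ?invr_gt0//.
by lra.
Qed.

Lemma expR1_le4 : expR 1 <= 4 :> R.
Proof.
rewrite (_ : expR 1 = expR (1 / 2) * expR (1 / 2)); last by rewrite -expRD -splitr.
rewrite (_ : 4 = 2 * 2); last by lra.
by apply: ler_pM; rewrite ?expR_ge0 ?expRhalf_le2.
Qed.

Lemma ln2_ge : 1 / 2 <= ln 2 :> R.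
Proof. by rewrite -(expRK (1 / 2)) ler_ln ?posrE ?expR_gt0 ?expRhalf_le2. Qed.

Lemma ln2_le : ln 2 <= 1 :> R.
Proof. by rewrite (_ : 2 = 1 + 1 :> R)//; apply: le_ln1Dx; lra. Qed.

Lemma ln_exp2 n : ln (2 ^+ n) = n%:R * ln 2 :> R.
Proof. by rewrite lnXn// mulr_natl. Qed.

Lemma LLx_LLn x k : x <= 2 ^+ k -> LLx x <= 3 * (LLn k)%:R.
Proof.
move=> xk.
have H1 : Logm x <= k.+1%:R.
  rewrite /Logm; case: (leP x (expR 1)) => xe; first by rewrite expRK ler1n.
  have x0 : 0 < x by rewrite (lt_trans _ xe)// expR_gt0.
  apply: (@le_trans _ _ (ln (2 ^+ k))); first by rewrite ler_ln ?posrE// exprn_gt0.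
  by rewrite ln_exp2 (@le_trans _ _ k%:R) ?ler_nat// ler_piMr ?ln2_le.
(* The two extra powers of 2 cover the floor [expR 1 <= 4] built into [Logm]; they lead to the
   factor 3, because [LLn k + 2 <= 3 * LLn k]. *)
have H2 : Num.max (Logm x) (expR 1) <= 2 ^+ (LLn k).+2.
  rewrite ge_max; apply/andP; split; last first.
    have e4 : expR 1 <= 2 ^+ 2 :> R by rewrite (le_trans expR1_le4)// expr2; lra.
    by apply: (le_trans e4); rewrite ler_eXn2l// ltr1n.
  apply: (le_trans H1); rewrite -natrX ler_nat.
  apply: (leq_trans (ltn_exp2_LLn k)); rewrite leq_exp2l//.
  by rewrite -[leqLHS]addn0 -addn2 leq_add2l.
rewrite /LLx {1}/Logm; apply: (@le_trans _ _ (ln (2 ^+ (LLn k).+2))).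
  by rewrite ler_ln ?posrE ?exprn_gt0// lt_max expR_gt0 orbT.
rewrite ln_exp2 (@le_trans _ _ (LLn k).+2%:R)//; first by rewrite ler_piMr ?ln2_le.
have : 1 <= (LLn k)%:R :> R by rewrite ler1n.
by rewrite -[(LLn k).+2]addn2 natrD; lra.
Qed.

Lemma phiLL_ge0 x : 0 <= phiLL x.
Proof. by rewrite /phiLL divr_ge0 ?sqr_ge0// (le_trans ler01)// LLx_ge1. Qed.

(** With [h v = Y * v / (Y + v)], the increment [h (2 * v) - h v] is [v * Y ^+ 2] over
    [(Y + 2 * v) * (Y + v)], a denominator of at most 6 times the square of the larger of [Y] and
    [v]. Sums over dyadic [v] therefore telescope. *)
Lemma min_telescope (Y v : R) : 0 <= Y -> 0 < v ->
  Num.min v (Y ^+ 2 / v) <=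
    6 * (Y * (2 * v) / (Y + 2 * v) - Y * v / (Y + v)).
Proof.
move=> Y0 v0.
have D1 : 0 < Y + 2 * v by lra.
have D2 : 0 < Y + v by lra.
have -> : 6 * (Y * (2 * v) / (Y + 2 * v) - Y * v / (Y + v)) =
    6 * (v * Y ^+ 2) / ((Y + 2 * v) * (Y + v)).
  by field; rewrite !gt_eqF.
rewrite ler_pdivlMr ?mulr_gt0//.
have [vY|Yv] := leP v Y.
  have -> : Num.min v (Y ^+ 2 / v) = v.
    by apply/min_idPl; rewrite ler_pdivlMr// expr2 ler_pM// ltW.
  by rewrite [leRHS]mulrCA ler_pM2l//; nra.
have -> : Num.min v (Y ^+ 2 / v) = Y ^+ 2 / v.
  by apply/min_idPr; rewrite ler_pdivrMr// expr2 ler_pM// ltW.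
rewrite mulrAC ler_pdivrMr//.
rewrite (_ : 6 * (v * Y ^+ 2) * v = Y ^+ 2 * (6 * v ^+ 2)); last by ring.
rewrite ler_wpM2l ?sqr_ge0//; nra.
Qed.

(** For [x > 2 ^+ k] one has [phiLL x >= x], so the minimum is [2 ^+ k]. For [x <= 2 ^+ k],
    [LLx_LLn] gives [2 ^+ k * vcut k x ^+ 2 <= 3 * phiLL x], which is then squared. *)
Lemma vcut4_le k x : 0 <= x ->
  2 ^+ k * vcut k x ^+ 4 <= 16 * Num.min (2 ^+ k) (phiLL x ^+ 2 / 2 ^+ k).
Proof.
move=> x0.
have k0 : 0 < 2 ^+ k :> R by rewrite exprn_gt0.
have v0 := vcut_ge0 k x0.
have v41 : vcut k x ^+ 4 <= 1 by rewrite exprn_ile1// vcut_le1.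
have le2k : 2 ^+ k * vcut k x ^+ 4 <= 2 ^+ k by rewrite ler_piMr// ltW.
rewrite -ler_pdivrMl// le_min !ler_pdivrMl//; apply/andP; split; first by lra.
rewrite [leRHS]mulrA ler_pdivlMr//.
have [xk|kx] := leP x (2 ^+ k); last first.
  have x1 : 1 <= x by apply: le_trans (ltW kx); rewrite exprn_ege1// ler1n.
  have Yx : x <= phiLL x.
    rewrite /phiLL -/(LLx x) ler_pdivlMr ?(lt_le_trans ltr01 (LLx_ge1 x))//.
    by rewrite expr2 ler_wpM2l// LLx_le.
  apply: (@le_trans _ _ (2 ^+ k * 2 ^+ k)); first by rewrite ler_wpM2r// ltW.
  rewrite (@le_trans _ _ (phiLL x ^+ 2))//; last by rewrite ler_peMl ?sqr_ge0; lra.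
  by rewrite expr2 ler_pM// ?ltW// (lt_le_trans kx).
have L1 : 1 <= (LLn k)%:R :> R by rewrite ler1n.
have LL := LLx_LLn xk; have LL1 := LLx_ge1 x.
have b2 := bscale_sqr k; have b0 := bscale_gt0 k.
have H : 2 ^+ k * vcut k x ^+ 2 <= 3 * phiLL x.
  apply: (@le_trans _ _ (2 ^+ k * (x / bscale k) ^+ 2)).
    rewrite ler_wpM2l// ?(ltW k0)// lerXn2r ?nnegrE ?divr_ge0 ?(ltW b0)//.
    by rewrite /vcut ge_min lexx orbT.
  rewrite expr_div_n b2 natrM natrX /phiLL -/(LLx x).
  rewrite (_ : 2 ^+ k * (x ^+ 2 / (2 ^+ k * (LLn k)%:R)) = x ^+ 2 / (LLn k)%:R); last first.
    by field; rewrite ?gt_eqF// (lt_le_trans ltr01).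
  rewrite [leRHS]mulrCA ler_wpM2l ?sqr_ge0// ler_pdivlMr; last by lra.
  by rewrite [leLHS]mulrC ler_pdivrMr//; lra.
have Y0 := phiLL_ge0 x.
rewrite (_ : 2 ^+ k * vcut k x ^+ 4 * 2 ^+ k = (2 ^+ k * vcut k x ^+ 2) ^+ 2); last by ring.
apply: (@le_trans _ _ ((3 * phiLL x) ^+ 2)).
  by rewrite lerXn2r// nnegrE mulr_ge0// exprn_ge0.
by rewrite exprMn ler_wpM2r ?sqr_ge0//; lra.
Qed.

(** Pointwise form of the summability of the [G_k]: the sum telescopes by [min_telescope] with [h]
    bounded by [phiLL x], and 96 is 16 times 6. *)
Lemma sum_vcut4 K x : 0 <= x ->
  \sum_(k < K) 2 ^+ k * vcut k x ^+ 4 <= 96 * phiLL x.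
Proof.
move=> x0; have Y0 := phiLL_ge0 x; set Y := phiLL x in Y0 *.
pose h k := Y * 2 ^+ k / (Y + 2 ^+ k).
have hh k : 2 ^+ k * vcut k x ^+ 4 <= 96 * (h k.+1 - h k).
  apply: (le_trans (vcut4_le k x0)).
  have /(min_telescope Y0) : 0 < 2 ^+ k :> R by rewrite exprn_gt0.
  by rewrite -/Y /h (exprS 2 k); lra.
apply: (@le_trans _ _ (96 * (h K - h 0%N))).
  elim: K => [|K IH]; first by rewrite big_ord0 subrr mulr0.
  by rewrite big_ord_recr /=; have := hh K; lra.
have h0 : 0 <= h 0%N by rewrite /h expr0 mulr1 divr_ge0// addr_ge0.
have hK : h K <= Y.
  have k0 : 0 < 2 ^+ K :> R by rewrite exprn_gt0.
  by rewrite /h -mulrA ler_piMr// ler_pdivrMr ?mul1r ?lerDr// ltr_wpDl.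
by lra.
Qed.

(** Take the largest admissible [kap]. If it is below [L], maximality gives [kap.+1 ^ 6 * G > 1],
    and [64 ^ kap = (2 ^ kap) ^ 6] is at least [kap.+1 ^ 6], hence exceeds the inverse of [G]. *)
Lemma block_count (G : R) (L : nat) : 0 <= G <= 1 -> (0 < L)%N ->
  exists kap, [/\ (0 < kap <= L)%N, kap%:R ^+ 6 * G <= 1 &
    64^-1 ^+ kap <= 64^-1 ^+ L + G].
Proof.
move=> /andP[G0 G1] L0.
pose Q kap := (0 < kap <= L)%N && (kap%:R ^+ 6 * G <= 1).
have exQ : exists kap, Q kap by exists 1%N; rewrite /Q L0 expr1n mul1r.
have bQ kap : Q kap -> (kap <= L)%N by move=> /andP[/andP[]].
case: (ex_maxnP exQ bQ) => kap /andP[/andP[k0 kL] kG] kmax.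
exists kap; split => //; first by rewrite k0.
move: kL; rewrite leq_eqVlt => /predU1P[->|kL]; first by rewrite lerDl.
have H : 1 < kap.+1%:R ^+ 6 * G.
  rewrite ltNge; apply/negP => H; have := kmax kap.+1.
  by rewrite /Q /= kL H => /(_ isT); rewrite ltnn.
rewrite (@le_trans _ _ G)//; last by rewrite lerDr exprn_ge0.
have k6 : 0 < kap.+1%:R ^+ 6 :> R by rewrite exprn_gt0.
rewrite exprVn (_ : 64 = 2 ^+ 6 :> R); last by rewrite -natrX.
rewrite exprAC -lef_pV2 ?posrE ?invr_gt0 ?exprn_gt0//; last first.
  by rewrite -(pmulr_rgt0 _ k6) (lt_trans _ H).
rewrite invrK; apply: (@le_trans _ _ (kap.+1%:R ^+ 6)).
  by rewrite invf_ple ?posrE//; [rewrite -div1r ler_pdivrMr// mulrC ltW|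
     rewrite -(pmulr_rgt0 _ k6) (lt_trans _ H)].
by rewrite lerXn2r ?nnegrE ?exprn_ge0// -natrX ler_nat ltn_expl.
Qed.

(** Since [k < 2 ^ LLn k], each term is at most the inverse square of [k.+1], which is bounded by a
    telescoping difference. *)
Lemma sum_LLn K : \sum_(k < K) 64^-1 ^+ LLn k <= 2 :> R.
Proof.
have H k : 64^-1 ^+ LLn k <= 2 * (k.+1%:R^-1 - k.+2%:R^-1) :> R.
  apply: (@le_trans _ _ (k.+1%:R ^+ 2)^-1).
    rewrite exprVn lef_pV2 ?posrE ?exprn_gt0//.
    apply: (@le_trans _ _ ((2 ^+ LLn k) ^+ 2)).
      by rewrite lerXn2r ?nnegrE ?exprn_ge0// -natrX ler_nat ltn_exp2_LLn.
    by rewrite exprAC lerXn2r ?nnegrE ?exprn_ge0// expr2; lra.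
  have k1 : 0 < k.+1%:R :> R by [].
  have -> : k.+2%:R = k.+1%:R + 1 :> R by rewrite natr1.
  have k1' : 1 <= k.+1%:R :> R by rewrite ler1n.
  move: (k.+1%:R : R) k1 k1' => t t0 t1.
  rewrite (_ : 2 * (t^-1 - (t + 1)^-1) = 2 / (t * (t + 1))); last by field; lra.
  rewrite ler_pdivlMr ?mulr_gt0//; last by lra.
  rewrite mulrC ler_pdivrMr ?exprn_gt0// expr2; nra.
apply: (@le_trans _ _ (2 * (1 - K.+1%:R^-1))).
  elim: K => [|K IH]; first by rewrite big_ord0 invr1 subrr mulr0.
  rewrite big_ord_recr /= (le_trans (lerD IH (H K)))//.
  by move: (K.+1%:R^-1 : R) (K.+2%:R^-1 : R) => r t; lra.
have : 0 <= K.+1%:R^-1 :> R by [].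
by move: (K.+1%:R^-1 : R) => r; lra.
Qed.

(** Here [2 ^ k <= 2 * n] and [LLn k <= 3 * ln k <= 6 * ln (ln n)], so the squared scale is at most
    [12 * n * ln (ln n)], below the square of the factor 4. *)
Lemma bscale_le n k : (16 <= k)%N -> (2 ^ k.-1 <= n)%N ->
  bscale k <= 4 * Num.sqrt (n%:R * ln (ln n%:R)).
Proof.
move=> k16 kn.
have k0 : (0 < k)%N by lia.
have n0 : (0 < n)%N by apply: leq_trans kn; rewrite expn_gt0.
have k16R : 16 <= k%:R :> R by rewrite (ler_nat _ 16).
have k0R : 0 < k%:R :> R by rewrite ltr0n.
have lnn : (k%:R - 1) / 2 <= ln n%:R :> R.
  apply: (@le_trans _ _ (ln (2 ^+ k.-1))); last first.
    by rewrite ler_ln ?posrE ?exprn_gt0 ?ltr0n// -natrX ler_nat.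
  rewrite ln_exp2 -subn1 natrB//; have := ln2_ge; nra.
(* For [k >= 16], [(k - 1) / 2] squared is at least [k], hence [k <= ln n ^ 2]. *)
have lnk : ln k%:R <= 2 * ln (ln n%:R) :> R.
  rewrite mulr_natl -lnXn; last by lra.
  by rewrite ler_ln ?posrE ?exprn_gt0//; [nra|lra].
have lnk1 : 1 <= ln k%:R :> R.
  by rewrite -[leLHS]expRK ler_ln ?posrE ?expR_gt0//; have := expR1_le4; lra.
have Lk : (LLn k)%:R <= 3 * ln k%:R :> R.
  have : ln (2 ^+ (trunc_log 2 k)) <= ln k%:R :> R.
    by rewrite ler_ln ?posrE ?exprn_gt0// -natrX ler_nat trunc_logP.
  rewrite ln_exp2 /LLn -natr1; have := ln2_ge.
  have : 0 <= (trunc_log 2 k)%:R :> R by [].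
  nra.
rewrite (_ : 4 = Num.sqrt 16); last first.
  by rewrite (_ : 16 = 4 ^+ 2) ?sqrtr_sqr ?ger0_norm// -natrX.
rewrite -sqrtrM//; apply: ler_wsqrtr; rewrite natrM.
have nk : (2 ^ k)%:R <= 2 * n%:R :> R.
  by rewrite -natrM ler_nat -(prednK k0) expnS leq_mul2l.
have n0R : 0 < n%:R :> R by rewrite ltr0n.
apply: (@le_trans _ _ (2 * n%:R * (6 * ln (ln n%:R)))); last by nra.
by apply: ler_pM => //; lra.
Qed.

End DyadicScales.

(** * Integrals of functions of one coordinate *)

Section CoordinateIntegrals.
Context (R : realType) (Z : ptopologicalType).
Local Notation ZB := (Borel Z).
Context (mu : {measure set ZB -> \bar R}) (pstar : ZB -> R) (P : probability (Seq Z) R).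
Hypothesis iidP : iid_law mu pstar P.
Hypothesis dens : is_density mu pstar.

Lemma coord_law i (A : set ZB) : measurable A ->
  P [set w : Seq Z | A (w i)] = dmeas mu pstar A.
Proof.
move=> mA; have [mp p0 p1] := dens.
have mA0 : measurable ([set w | A (w 0%N)] : set (Seq Z)).
  by rewrite -[X in measurable X]setTI; exact: (@measurable_coord Z 0).
transitivity (P [set w : Seq Z | A (w 0%N)]).
  rewrite -(shift_stationary iidP i mA0); congr (P _).
  by apply/seteqP; split => w /=; rewrite /shift addn0.
have := iidP 1 (fun _ => mA); rewrite big_ord_recl big_ord0 mulr1 fineK; last first.
  rewrite ge0_fin_numE; last by rewrite /dmeas; apply: integral_ge0 => z _; rewrite lee_fin.
  apply: (@le_lt_trans _ _ 1%E); last by rewrite ltry.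
  rewrite -p1 /dmeas; apply: ge0_subset_integral => //; first exact/measurable_EFinP.
  by move=> z _; rewrite lee_fin.
move=> <-; congr (P _); apply/seteqP; split => w /=; first by move=> H [].
by move=> /(_ 0%N isT).
Qed.

Lemma integral_coord_stationary i (f : ZB -> \bar R) :
  measurable_fun setT f -> (forall z, (0 <= f z)%E) ->
  (\int[P]_w f (w i) = \int[P]_w f (w 0%N))%E.
Proof.
move=> mf f0.
rewrite -[LHS](@ge0_integral_pushforward _ _ _ _ R _ (measurable_coord i) P setT f)//.
rewrite -[RHS](@ge0_integral_pushforward _ _ _ _ R _ (measurable_coord 0) P setT f)//.
apply: eq_measure_integral; [exact: measurable_coord..|move=> ? ? A mA _].
by rewrite /pushforward [LHS](coord_law i mA) [RHS](coord_law 0 mA).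
Qed.

Import HBNNSimple.

(** For simple functions both integrals agree, level set by level set, by [coord_law]. The
    increasing simple approximations of [f] lie below [f], and monotone convergence on the left
    yields the bound. *)
Lemma integral_coord_le (f : ZB -> R) :
  measurable_fun setT f -> (forall z, 0 <= f z) ->
  (\int[P]_w (f (w 0%N))%:E <= \int[mu]_z (f z * pstar z)%:E)%E.
Proof.
move=> mf f0; have [mp p0 _] := dens.
have mfE : measurable_fun setT (EFin \o f) by exact/measurable_EFinP.
pose nu0 : {measure set ZB -> \bar R} := pushforward P (fun w : Seq Z => w 0%N : ZB).
pose nu := nu0 (measurable_coord 0).
have nuE A : measurable A -> nu A = (\int[mu]_(z in A) (pstar z)%:E)%E.
  by move=> mA; exact: (coord_law 0 mA).
rewrite -[leLHS](@ge0_integral_pushforward _ _ _ _ R _ (measurable_coord 0) P setT (EFin \o f))//; last first.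
  by move=> z _; rewrite lee_fin.
rewrite -/nu0 -/nu.
pose h := nnsfun_approx measurableT mfE.
have hf n z : h n z <= f z.
  rewrite -lee_fin /h nnsfun_approxE; apply: (@le_approx _ _ _ setT (EFin \o f)) => //.
  by move=> x _; rewrite lee_fin.
have -> : (\int[nu]_x (EFin \o f) x = limn (fun n => \int[nu]_x (h n x)%:E))%E.
  have fE x : (EFin \o f) x = limn (fun n => (EFin \o h n) x).
    by apply/esym/cvg_lim => //; apply: cvg_nnsfun_approx => // t _; rewrite lee_fin.
  under eq_integral do rewrite fE.
  apply: monotone_convergence => //.
  - by move=> n; apply/measurable_EFinP.
  - by move=> n x _ /=; rewrite lee_fin.
  - by move=> x _ a b ab; rewrite lee_fin; exact/lefP/nd_nnsfun_approx.
apply: lime_le.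
  apply: ereal_nondecreasing_is_cvgn => a b ab; apply: ge0_le_integral => //.
  - by move=> x _; rewrite lee_fin.
  - by apply/measurable_EFinP.
  - by apply/measurable_EFinP.
  - by move=> x _; rewrite lee_fin; exact/lefP/nd_nnsfun_approx.
apply: nearW => n.
have mpE : measurable_fun setT (EFin \o pstar) by exact/measurable_EFinP.
apply: (@le_trans _ _ (\int[mu]_z ((h n z)%:E * (pstar z)%:E))%E); last first.
  apply: ge0_le_integral => //.
  - by move=> z _; rewrite mule_ge0 ?lee_fin.
  - by apply: emeasurable_funM => //; exact/measurable_EFinP.
  - by apply/measurable_EFinP; exact: measurable_funM.
  - by move=> z _; rewrite -EFinM lee_fin ler_wpM2r.
have -> : (\int[mu]_z ((h n z)%:E * (pstar z)%:E) =
   \int[mu]_z (\sum_(y \in range (h n)) ((y * \1_(h n @^-1` [set y]) z)%:E * (pstar z)%:E)))%E.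
  apply: eq_integral => z _.
  rewrite -ge0_mule_fsuml => [|y]; last exact: nnfun_muleindic_ge0.
  by rewrite fsumEFin // -(fimfunE _ z).
have -> : (\int[nu]_z (h n z)%:E =
   \int[nu]_z (\sum_(y \in range (h n)) (y * \1_(h n @^-1` [set y]) z)%:E))%E.
  by apply: eq_integral => t _; rewrite /= fimfunE -fsumEFin.
have indich r : measurable_fun setT (fun x => (r * \1_(h n @^-1` [set r]) x)%:E).
  by apply: (measurable_comp measurableT) => //; exact: measurable_funM.
rewrite ge0_integral_fsum//; last by move=> m y Ey; exact: nnfun_muleindic_ge0.
rewrite ge0_integral_fsum//; last 2 first.
  - by move=> y; apply: emeasurable_funM.
  - by move=> m y Ey; apply: mule_ge0; [exact: nnfun_muleindic_ge0|rewrite lee_fin].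
rewrite le_eqVlt; apply/orP; left; apply/eqP; apply: eq_fsbigr => r.
rewrite inE => -[z0 _ hz0].
have r0 : 0 <= r by rewrite -hz0.
under eq_integral do rewrite EFinM.
rewrite ge0_integralZl//; last by apply/measurable_EFinP.
rewrite integral_indic// setIT nuE//.
under [RHS]eq_integral do rewrite EFinM -muleA.
rewrite ge0_integralZl//; last 2 first.
- by apply: emeasurable_funM => //; exact/measurable_EFinP.
- by move=> z _; rewrite mule_ge0 ?lee_fin.
congr (_ * _)%E; rewrite [LHS]integral_mkcond; apply: eq_integral => z _.
rewrite /patch indicE; case: ifPn => _; by rewrite ?mul1e ?mul0e.
Qed.

End CoordinateIntegrals.

(** * The probability bound on one dyadic block *)

Section IteratedLogarithm.
Context (R : realType) (Z : ptopologicalType).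
Local Notation ZB := (Borel Z).
Context (mu : {measure set ZB -> \bar R}) (pstar : ZB -> R) (P : probability (Seq Z) R).
Hypothesis iidP : iid_law mu pstar P.
Hypothesis dens : is_density mu pstar.

Definition EP (h : Z -> R) : R := fine (\int[P]_w (h (w 0%N))%:E).

Lemma EP_fin (h : Z -> R) : measurable_fun setT (h : ZB -> R) ->
  (forall z, 0 <= h z <= 1) -> (\int[P]_w (h (w 0%N))%:E = (EP h)%:E)%E.
Proof.
move=> mh h01; rewrite /EP fineK// ge0_fin_numE; last first.
  by apply: integral_ge0 => w _; rewrite lee_fin; case/andP: (h01 (w 0%N)).
have mhE : measurable_fun setT (fun w : Seq Z => (h (w 0%N))%:E).
  by apply/measurable_EFinP; exact: (measurableT_comp mh (measurable_coord 0)).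
apply: (@le_lt_trans _ _ (\int[P]_w cst 1%E w)%E); last first.
  rewrite integral_cst// mul1e (le_lt_trans (probability_le1 P measurableT))//.
  exact: ltry.
apply: ge0_le_integral => //.
- by move=> w _; rewrite lee_fin; case/andP: (h01 (w 0%N)).
- by move=> w _; rewrite lee_fin; case/andP: (h01 (w 0%N)).
Qed.

Lemma EP_ge0 (h : Z -> R) : (forall z, 0 <= h z <= 1) -> 0 <= EP h.
Proof.
move=> h01; rewrite /EP fine_ge0// integral_ge0// => w _.
by rewrite lee_fin; case/andP: (h01 (w 0%N)).
Qed.

Definition sumge (h : Z -> R) (N : nat) (y : R) : set (Seq Z) :=
  [set w | y <= \sum_(l < N) h (w l)].

Lemma measurable_sumge (h : Z -> R) N y : measurable_fun setT (h : ZB -> R) ->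
  measurable (sumge h N y).
Proof.
move=> mh; rewrite -[X in measurable X]setTI.
rewrite (_ : sumge h N y = psum (fun=> h) N 0 @^-1` `[y, +oo[); last first.
  by apply/seteqP; split => w /=; rewrite in_itv /= andbT.
by apply: measurable_psum => // j.
Qed.

(** Markov's inequality, the [N] terms having equal expectations by stationarity. *)
Lemma sum_markov (h : Z -> R) N y : measurable_fun setT (h : ZB -> R) ->
  (forall z, 0 <= h z <= 1) -> 0 < y ->
  Pr P (sumge h N y) <= N%:R * EP h / y.
Proof.
move=> mh h01 y0; set A := sumge h N y.
have h0 z : 0 <= h z by case/andP: (h01 z).
have mA : measurable A by exact: measurable_sumge.
have mhE l : measurable_fun setT (fun w : Seq Z => (h (w l))%:E).
  by apply/measurable_EFinP; exact: (measurableT_comp mh (measurable_coord l)).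
rewrite ler_pdivlMr// mulrC -lee_fin !EFinM -PrE//.
have <- : (\int[P]_w (\sum_(l < N) (h (w l))%:E) = N%:R%:E * (EP h)%:E)%E.
  rewrite ge0_integral_sum//; last by move=> n w _; rewrite lee_fin.
  have Eh (l : nat) : (\int[P]_w (h (w l))%:E = (EP h)%:E)%E.
    rewrite -EP_fin//; apply: (integral_coord_stationary iidP dens l (f := EFin \o h)).
    - exact/measurable_EFinP.
    - by move=> z; rewrite lee_fin.
  under eq_bigr do rewrite Eh.
  by rewrite sumEFin sumr_const card_ord -EFinM mulr_natl.
have <- : (\int[P]_w (y%:E * (\1_A w)%:E) = y%:E * P A)%E.
  rewrite ge0_integralZl//; [|by apply/measurable_EFinP|by rewrite lee_fin ltW].
  by rewrite integral_indic// setIT.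
apply: ge0_le_integral => //.
- by move=> w _; rewrite mule_ge0 ?lee_fin// ltW.
- by apply: measurable_funeM; apply/measurable_EFinP.
- by apply: emeasurable_sum.
- move=> w _; rewrite sumEFin -EFinM lee_fin indicE.
  have [/[!inE] Aw|_] := boolP (w \in A); last by rewrite mulr0 sumr_ge0.
  by rewrite mulr1.
Qed.

Section Block.
Variables (F : Z -> R) (f : nat -> Z -> R) (e : nat -> R) (c0 M : R) (n0 : nat).
Hypothesis mF : measurable_fun setT (F : ZB -> R).
Hypothesis mf : forall j, measurable_fun setT (f j : ZB -> R).
Hypothesis fF : forall j z, `|f j z| <= F z.
Hypothesis ec : forall j, `|e j| <= c0.
Hypothesis M0 : 0 <= M.

Let g j z := f j z - e j.

Hypothesis tight : forall n, (n0 <= n)%N ->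
  Pr P (exc g n (M * Num.sqrt n%:R)) <= 1 / 2048.

Let F0 z : 0 <= F z. Proof. exact: le_trans (fF 0 z). Qed.

Lemma measurable_class j : measurable_fun setT (g j : ZB -> R).
Proof. by apply: measurable_funB. Qed.

Let v k (z : Z) := vcut k (F z).
Let v4 k (z : Z) := v k z ^+ 4.

Let mv k : measurable_fun setT (v k : ZB -> R).
Proof. by apply: measurable_minr => //; apply: measurable_funM. Qed.

Let mv4 k : measurable_fun setT (v4 k : ZB -> R).
Proof. exact: measurable_funX. Qed.

Let v01 k z : 0 <= v k z <= 1.
Proof. by rewrite vcut_ge0//= vcut_le1. Qed.

Let v401 k z : 0 <= v4 k z <= 1.
Proof. by have /andP[? ?] := v01 k z; rewrite exprn_ge0//= exprn_ile1. Qed.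

Definition blockG k : R := 2 ^+ k * EP (fun z => vcut k (F z) ^+ 4).

(** Three bad events: the truncated walk is large ([H3]), the large steps add up ([H4]), some
    envelope value exceeds [b] ([H5]). Their bounds [64^-1 ^+ kap], [G] and [G] sum to the claim, by
    the choice of [kap]. *)
Lemma block_bound k : (4 <= k)%N -> (n0 <= k)%N -> c0 ^+ 2 <= k%:R ->
  blockG k <= (1 / 1024) ^+ 2 ->
  Pr P (maxexc g (2 ^ k) ((16 * M + 7) * bscale R k)) <=
    64^-1 ^+ LLn k + 3 * blockG k.
Proof.
move=> k4 n0k c0k Gsmall; set G := blockG k in Gsmall *.
set N := (2 ^ k)%N; set b := bscale R k; set L := LLn k.
have k0 : (0 < k)%N by lia.
have N0 : (0 < N)%N by rewrite expn_gt0.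
have NR : N%:R = 2 ^+ k :> R by rewrite natrX.
have b0 : 0 < b := bscale_gt0 R k.
have E0 : 0 <= EP (v4 k) by exact: EP_ge0.
have GE : G = N%:R * EP (v4 k) by rewrite NR.
have G0 : 0 <= G by rewrite GE mulr_ge0.
have [eps [eps0 eps1 epsE]] : exists eps : R, [/\ 0 <= eps, eps <= 1 & eps = 1 / 1024].
  by exists (1 / 1024); split; [lra|lra|reflexivity].
rewrite -epsE in Gsmall.
have G1 : G <= 1 by apply: (le_trans Gsmall); rewrite exprn_ile1.
have [kap [/andP[kap0 kapL] kapG kap64]] : exists kap, [/\ (0 < kap <= L)%N,
    kap%:R ^+ 6 * G <= 1 & 64^-1 ^+ kap <= 64^-1 ^+ L + G].
  by apply: block_count; rewrite ?G0.
have kapk : (kap <= k)%N by rewrite (leq_trans kapL)// LLn_leq.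
have kkN : (k * k <= N)%N by exact: leq_sqr_exp2.
have kap0R : 0 < kap%:R :> R by rewrite ltr0n.
pose B := b / kap%:R.
have B0 : 0 < B by rewrite divr_gt0.
have bB : b = kap%:R * B by rewrite /B mulrC divfK// gt_eqF.
(* [B ^+ 2] equals [N * L / kap ^ 2], and [kap <= L]. *)
have B2 : N%:R / kap%:R <= B ^+ 2.
  rewrite /B expr_div_n bscale_sqr -/N -/L natrM ler_pdivlMr ?exprn_gt0//.
  rewrite expr2 mulrA divfK ?gt_eqF// ler_wpM2l// ler_nat//.
have kB2 : k%:R <= B ^+ 2.
  apply: le_trans B2; rewrite ler_pdivlMr// -natrM ler_nat.
  by rewrite (leq_trans _ kkN)// leq_mul2l kapk orbT.
have c0B : c0 <= B.
  have [c00|c00] := leP 0 c0; last by rewrite (le_trans (ltW c00))// ltW.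
  rewrite -(ler_pXn2r (isT : (0 < 2)%N)) ?nnegrE// ?(ltW B0)//.
  exact: le_trans kB2.
(* Rounding up lets [kap] pieces of length [m] cover the block; [m] still has order [N / kap] and is
   at least [k], hence at least [n0]. *)
pose m := (N %/ kap).+1.
have Nm : (N <= kap * m)%N by rewrite mulnC ltnW// ltn_ceil.
have mN : (m * kap <= 2 * N)%N.
  rewrite /m mulSn mul2n -addnn leq_add// ?leq_trunc_div//.
  by rewrite (leq_trans kapk)// (leq_trans _ kkN)// leq_pmulr.
have km : (k <= m)%N.
  by rewrite /m ltnW// ltnS leq_divRL// (leq_trans _ kkN)// leq_mul2l kapk orbT.
have mNR : m%:R * kap%:R <= 2 * N%:R :> R by rewrite -!natrM ler_nat.
(* Only [f] is truncated; the centring stays [e], and [c0 <= B] bounds the steps by [2 * B]. *)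
pose g' j z := (if F z <= B then f j z else 0) - e j.
have mg' j : measurable_fun setT (g' j : ZB -> R).
  apply: measurable_funB => //; apply: measurable_fun_ifT => //.
  exact: measurable_fun_ler.
have g'B j z : `|g' j z| <= 2 * B.
  rewrite /g' (le_trans (ler_normB _ _))// mulr2n mulrDl mul1r lerD//.
    by case: ifPn => [FB|_]; rewrite ?normr0 ?(ltW B0)// (le_trans (fF j z)).
  exact: le_trans c0B.
(* The large steps in units of [b], as a class constant in [j] so that the maximal inequalities
   apply to it. *)
pose xi (j : nat) z := if F z <= B then 0 else v k z.
have mxi j : measurable_fun setT (xi j : ZB -> R).
  apply: measurable_fun_ifT => //; exact: measurable_fun_ler.
have xi01 j z : 0 <= xi j z <= 1.
  by rewrite /xi; case: ifP => _; rewrite ?lexx ?ler01.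
have xi1 j z : `|xi j z| <= 1 by have /andP[? ?] := xi01 j z; rewrite ger0_norm.
have vB z : B < F z -> kap%:R^-1 <= v k z.
  move=> BF; rewrite /v /vcut le_min; apply/andP; split.
    by rewrite invf_le1// ler1n.
  rewrite ler_pdivlMr// mulrC; exact: ltW.
have kG2 : (kap%:R ^+ 3 * G) ^+ 2 <= G.
  rewrite exprMn -exprM (expr2 G) mulrA ler_piMl//.
(* From [kap ^ 6 * G <= 1] the square of [kap ^ 3 * G] is at most [G], hence at most the square of
   1/1024. *)
have kG : kap%:R ^+ 3 * G <= eps.
  rewrite -(ler_pXn2r (isT : (0 < 2)%N)) ?nnegrE ?mulr_ge0 ?exprn_ge0//.
  exact: le_trans Gsmall.
have PV n y : 0 < y -> Pr P (sumge (v4 k) n y) <= n%:R * EP (v4 k) / y.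
  by move=> y0; apply: sum_markov.
have mV n y : measurable (sumge (v4 k) n y) by exact: measurable_sumge.
pose a := 8 * M * B.
have a0 : 0 <= a by rewrite !mulr_ge0// ltW.
have mg := measurable_class.
(* [exc_short] doubles 1/2048 to 1/1024 and [ottaviani] at most doubles it again. The level fits
   because [m + n0 <= 2 * m], so [Num.sqrt (m + n0)] is at most [2 * B]. *)
have H1 : Pr P (maxexc g m a) <= 1 / 512.
  pose t := 2 * M * Num.sqrt (m + n0)%:R.
  have t0 : 0 <= t by rewrite !mulr_ge0.
  have ta : t + t <= a.
    rewrite -mulr2n -mulr_natl /t /a (_ : 8 * M * B = 2 * (2 * M * (2 * B))); last by ring.
    rewrite ler_wpM2l// ler_wpM2l ?mulr_ge0//.
    have B20 : 0 <= 2 * B by rewrite mulr_ge0// ltW.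
    rewrite (_ : 2 * B = Num.sqrt ((2 * B) ^+ 2)); last by rewrite sqrtr_sqr ger0_norm.
    rewrite ler_wsqrtr//.
    rewrite exprMn (@le_trans _ _ (2 ^+ 2 * (N%:R / kap%:R)))//; last first.
      by rewrite ler_wpM2l// exprn_ge0.
    rewrite mulrA ler_pdivlMr//.
    apply: (@le_trans _ _ (2 * m%:R * kap%:R)).
      rewrite ler_wpM2r// -natrM ler_nat mul2n -addnn leq_add2l.
      exact: leq_trans km.
    by rewrite -mulrA expr2 -[leRHS]mulrA ler_wpM2l.
  have Hd i : (i <= m)%N -> Pr P (exc g i t) <= 1 / 1024.
    move=> im; have := @exc_short R Z mu pstar P iidP g mg M (1 / 2048) n0 M0 tight m i im.
    by rewrite -/t; lra.
  have := @ottaviani R Z mu pstar P iidP g mg t (1 / 1024) m t0 Hd.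
  have := @le_Pr R Z P _ _ (measurable_maxexc mg m a) (measurable_maxexc mg m (t + t)) (maxexcS ta).
  by lra.
(* The walks of [g] and [g'] agree unless one of [m] envelope values exceeds [B]. Such a value has
   [v ^ 4 >= kap ^ -4], so Markov adds at most [2 * kap ^ 3 * G <= 1/512]. *)
have H2 : Pr P (maxexc g' m a) <= 1 / 256.
  have sub : maxexc g' m a `<=` maxexc g m a `|` sumge (v4 k) m (kap%:R ^+ 4)^-1.
    move=> w [i im [j Hj]].
    have [[l lm Bl]|nl] := pselect (exists2 l, (l < m)%N & B < F (w l)).
      right; rewrite /sumge /= (bigD1 (Ordinal lm))//= ler_wpDr//.
        by apply: sumr_ge0 => l' _; case/andP: (v401 k (w l')).
      by rewrite /v4 -exprVn lerXn2r ?nnegrE ?invr_ge0//; [case/andP: (v01 k (w l))|exact: vB].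
    left; exists i => //; exists j; move: Hj; rewrite /psum.
    rewrite (eq_bigr (fun l : 'I_i => g j (w l)))// => l _; rewrite /g' /g.
    case: ifPn => //; rewrite -ltNge => BF; exfalso; apply: nl; exists l => //.
    by rewrite (leq_trans (ltn_ord l)).
  have := le_Pr P (measurable_maxexc mg' m a) (measurableU _ _ (measurable_maxexc mg m a) (mV _ _)) sub.
  move=> /le_trans /(_ (PrU P (measurable_maxexc mg m a) (mV m (kap%:R ^+ 4)^-1))).
  have : Pr P (sumge (v4 k) m (kap%:R ^+ 4)^-1) <= 2 * (kap%:R ^+ 3 * G).
    apply: (le_trans (PV _ _ _)); first by rewrite invr_gt0 exprn_gt0.
    rewrite invrK GE.
    rewrite (_ : m%:R * EP (v4 k) * kap%:R ^+ 4 =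
      (m%:R * kap%:R) * (kap%:R ^+ 3 * EP (v4 k))); last by ring.
    rewrite (_ : 2 * (kap%:R ^+ 3 * (N%:R * EP (v4 k))) =
      2 * N%:R * (kap%:R ^+ 3 * EP (v4 k))); last by ring.
    by rewrite ler_wpM2r// mulr_ge0// exprn_ge0.
  by move: kG; rewrite epsE; lra.
(* [2 * kap] excursions of height [a + 2 * B] make up [(16 * M + 4) * b]; each of the [kap] pieces
   contributes [256 * (2 / 256) ^ 2 = 1 / 64]. *)
have H3 : Pr P (maxexc g' (kap * m) ((16 * M + 4) * b)) <= 64^-1 ^+ kap.
  have := @maxexc_tail R Z mu pstar P iidP g' mg' (2 * B) a (1 / 256) m kap (2 * kap) a0.
  rewrite (_ : (2 * kap)%:R * (a + 2 * B) = (16 * M + 4) * b); last first.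
    by rewrite natrM bB /a; ring.
  move=> /(_ _ _ g'B H2); rewrite exprM -exprMn.
  rewrite (_ : (1 / 256)^-1 * (2 * (1 / 256)) ^+ 2 = 64^-1 :> R); last by field.
  by apply; lra.
(* Where [xi] is nonzero, [v >= 1 / kap], so [xi <= kap ^ 3 * v ^ 4] and level 1 is exceeded with
   probability at most [kap ^ 3 * G]. The recurrence with unit levels and an empty remainder squares
   this. *)
have H4 : Pr P (maxexc xi N 3) <= G.
  have Hx : Pr P (maxexc xi N 1) <= kap%:R ^+ 3 * G.
    have sub : maxexc xi N 1 `<=` sumge (v4 k) N (kap%:R ^+ 3)^-1.
      move=> w [i iN [j Hj]]; rewrite /sumge /=.
      rewrite -[leLHS]mul1r ler_pdivrMr ?exprn_gt0//.
      apply: (le_trans (ltW Hj)); rewrite ger0_norm; last first.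
        by apply: sumr_ge0 => l _; case/andP: (xi01 j (w l)).
      apply: (@le_trans _ _ (\sum_(l < N) xi j (w l))).
        rewrite (_ : \sum_(l < N) _ = psum xi i j w + psum xi (N - i) j (shift i w)).
          by rewrite lerDl; apply: sumr_ge0 => l _; case/andP: (xi01 j (shift i w l)).
        by rewrite -psumD subnKC.
      rewrite mulr_suml; apply: ler_sum => l _; rewrite /xi.
      have [v0 _] := andP (v01 k (w l)).
      case: ifPn => [_|]; first by rewrite mulr_ge0 ?exprn_ge0.
      rewrite -ltNge => /vB vk; rewrite /v4 exprS -mulrA ler_peMr// -exprMn.
      by rewrite exprn_ege1// -ler_pdivrMr// div1r.
    apply: (le_trans (le_Pr P (measurable_maxexc mxi _ _) (mV _ _) sub)).
    apply: (le_trans (PV _ _ _)); first by rewrite invr_gt0 exprn_gt0.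
    by rewrite invrK GE mulrC.
  have := @maxexc_recurrence R Z mu pstar P iidP xi mxi 1 1 1 N N (leqnn N) ler01 ler01 xi1.
  rewrite subnn Pr_maxexc0// addr0 (_ : 1 + 1 + 1 = 3); last by ring.
  move=> /le_trans; apply; apply: le_trans kG2.
  by rewrite expr2 ler_pM ?Pr_ge0.
have H5 : Pr P (sumge (v4 k) N 1) <= G by have := PV N 1 ltr01; rewrite divr1 -GE.
have sub : maxexc g N ((16 * M + 7) * b) `<=`
    maxexc g' (kap * m) ((16 * M + 4) * b) `|` (maxexc xi N 3 `|` sumge (v4 k) N 1).
  move=> w [i iN [j Hj]].
  apply: contrapT => /not_orP[n1 /not_orP[n2 n3]].
  have Fb l : (l < N)%N -> F (w l) <= b.
    move=> lN; rewrite leNgt; apply/negP => bF; apply: n3.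
    rewrite /sumge /= (bigD1 (Ordinal lN))//= ler_wpDr//.
      by apply: sumr_ge0 => l' _; case/andP: (v401 k (w l')).
    rewrite /v4 /v /vcut (_ : Num.min _ _ = 1) ?expr1n//; apply/min_idPl.
    by rewrite ler_pdivlMr// mul1r ltW.
  have S1 : `|psum g' i j w| <= (16 * M + 4) * b.
    rewrite leNgt; apply/negP => H; apply: n1; exists i; last by exists j.
    exact: leq_trans Nm.
  have S2 : `|psum xi i 0 w| <= 3.
    by rewrite leNgt; apply/negP => H; apply: n2; exists i => //; exists 0%N.
  (* The walks differ by the values of [f] at the large steps; there [F <= b], so [F] is exactly [b]
     times [v]. *)
  have S3 : `|psum g i j w - psum g' i j w| <= b * `|psum xi i 0 w|.
    rewrite /psum -sumrB [X in b * X]ger0_norm; last first.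
      by apply: sumr_ge0 => l _; case/andP: (xi01 0%N (w l)).
    rewrite mulr_sumr (le_trans (ler_norm_sum _ _ _))//; apply: ler_sum => l _.
    rewrite /g /g' /xi; case: ifPn => FB.
      by rewrite subrr normr0 mulr0.
    rewrite sub0r opprK subrK (le_trans (fF j _))//.
    have Fbl : F (w l) <= b by apply: Fb; rewrite (leq_trans (ltn_ord l)).
    rewrite /v /vcut (_ : Num.min _ _ = F (w l) / b); last first.
      by apply/min_idPr; rewrite ler_pdivrMr// mul1r.
    by rewrite mulrC divfK// gt_eqF.
  move: Hj; rewrite ltNge => /negP; apply.
  rewrite -[psum g i j w](subrK (psum g' i j w)) (le_trans (ler_normD _ _))//.
  apply: (le_trans (lerD S3 S1)).
  have : b * `|psum xi i 0 w| <= b * 3 by rewrite ler_wpM2l// ltW.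
  by lra.
have mU : measurable (maxexc xi N 3 `|` sumge (v4 k) N 1).
  by apply: measurableU; [exact: measurable_maxexc|exact: mV].
have mM := measurable_maxexc mg' (kap * m) ((16 * M + 4) * b).
have := le_Pr P (measurable_maxexc mg _ _) (measurableU _ _ mM mU) sub.
move=> /le_trans; apply; apply: (le_trans (PrU P mM mU)).
have := PrU P (measurable_maxexc mxi N 3) (mV N 1).
by lra.
Qed.

End Block.
End IteratedLogarithm.

(** * Borel-Cantelli with real-valued bounds *)

Section BorelCantelli.
Context (R : realType) (Z : ptopologicalType) (P : probability (Seq Z) R).

Lemma bounded_sums_small (u : nat -> R) (C eps : R) : (forall k, 0 <= u k) ->
  (forall K, \sum_(k < K) u k <= C) -> 0 < eps ->
  exists K, forall k, (K <= k)%N -> u k <= eps.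
Proof.
move=> u0 uC e0.
have cu : cvgn (series u).
  apply: nondecreasing_is_cvgn.
    by apply/nondecreasing_seqP => n; rewrite /series /= big_nat_recr//= lerDl.
  by exists C => _ [n _ <-]; rewrite /series /= big_mkord.
have /cvgrPdist_le/(_ _ e0)[K _ HK] := cvg_series_cvg_0 cu.
exists K => k Kk; have := HK k Kk; rewrite sub0r normrN; apply: le_trans.
exact: ler_norm.
Qed.

Lemma borel_cantelli (A : nat -> set (Seq Z)) (u : nat -> R) (C : R) k1 :
  (forall k, measurable (A k)) -> (forall k, 0 <= u k) ->
  (forall K, \sum_(k < K) u k <= C) ->
  (forall k, (k1 <= k)%N -> Pr P (A k) <= u k) ->
  {ae P, forall w, exists K, forall k, (K <= k)%N -> ~ A k w}.
Proof.
move=> mA u0 uC Au.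
(* The bound holds from [k1] on only, so the earlier events are replaced by the empty set. *)
pose B k := if (k1 <= k)%N then A k else set0.
have mB k : measurable (B k) by rewrite /B; case: ifP.
have PB k : (P (B k) <= (u k)%:E)%E.
  rewrite /B; case: ifP => [kk|_]; last by rewrite measure0 lee_fin.
  by rewrite (PrE P (mA k)) lee_fin Au.
have fin : (\sum_(n <oo) P (B n) < +oo)%E.
  apply: (@le_lt_trans _ _ C%:E); last by rewrite ltry.
  apply: lime_le; first exact: is_cvg_nneseries.
  apply: nearW => n; rewrite /= (@le_trans _ _ (\sum_(0 <= i < n) (u i)%:E)%E)//.
    by apply: lee_sum => i _; exact: PB.
  by rewrite sumEFin lee_fin big_mkord.
have P0 := lim_sup_set_cvg0 mB fin.
exists (lim_sup_set B); split => //.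
  by apply: bigcapT_measurable => n; apply: bigcup_measurable => j _.
move=> w /= nw n _ /=.
apply: contrapT => H; apply: nw; exists (maxn k1 n) => k.
rewrite geq_max => /andP[kk nk] Ak; apply: H; exists k => //.
by rewrite /B kk.
Qed.

End BorelCantelli.

(** * The bounded law of the iterated logarithm for a countable class *)

Section BoundedLIL.
Context (R : realType) (Z : ptopologicalType).
Local Notation ZB := (Borel Z).
Context (mu : {measure set ZB -> \bar R}) (pstar : ZB -> R) (P : probability (Seq Z) R).
Hypothesis iidP : iid_law mu pstar P.
Hypothesis dens : is_density mu pstar.

(** Integrates the pointwise bound [sum_vcut4] against the law of one coordinate. *)
Lemma sum_blockG (F : Z -> R) : measurable_fun setT (F : ZB -> R) ->
  (forall z, 0 <= F z) -> L1_dens mu pstar (fun z => phiLL (F z)) ->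
  exists C, forall K, \sum_(k < K) blockG P F k <= C.
Proof.
move=> mF F0 iF; have [mp p0 _] := dens.
have mv k : measurable_fun setT ((fun z => vcut k (F z)) : ZB -> R).
  by apply: measurable_minr => //; apply: measurable_funM.
have v01 k z : 0 <= vcut k (F z) ^+ 4 <= 1.
  by rewrite exprn_ge0 ?vcut_ge0//= exprn_ile1 ?vcut_ge0// vcut_le1.
have mv4 k : measurable_fun setT ((fun z => vcut k (F z) ^+ 4) : ZB -> R).
  exact: measurable_funX.
have mv4P k : measurable_fun setT (fun w : Seq Z => (vcut k (F (w 0%N)) ^+ 4)%:E).
  by apply/measurable_EFinP; exact: (measurableT_comp (mv4 k) (measurable_coord 0)).
have iF96 : mu.-integrable setT (fun z => 96%:E * (phiLL (F z) * pstar z)%:E)%E.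
  exact: integrableZl.
exists (fine (\int[mu]_z (96%:E * (phiLL (F z) * pstar z)%:E))%E) => K.
rewrite -lee_fin fineK; last exact: integrable_fin_num.
pose h z := \sum_(k < K) 2 ^+ k * vcut k (F z) ^+ 4.
have mh : measurable_fun setT (h : ZB -> R).
  by apply: measurable_sum => k; apply: measurable_funM.
have h0 z : 0 <= h z.
  apply: sumr_ge0 => k _; rewrite mulr_ge0 ?exprn_ge0//.
  exact: vcut_ge0.
have -> : ((\sum_(k < K) blockG P F k)%:E = \int[P]_w (h (w 0%N))%:E)%E.
  rewrite -sumEFin.
  have hE : (fun w : Seq Z => (h (w 0%N))%:E) =
      (fun w => \sum_(k < K) ((2 ^+ k)%:E * (vcut k (F (w 0%N)) ^+ 4)%:E))%E.
    by apply/funext => w; rewrite /h -sumEFin; apply: eq_bigr => k _; rewrite EFinM.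
  rewrite hE ge0_integral_sum//; last 2 first.
  - by move=> k; apply: measurable_funeM.
  - move=> k w _; rewrite mule_ge0 ?lee_fin ?exprn_ge0//.
    exact: vcut_ge0.
  apply: eq_bigr => k _; rewrite ge0_integralZl//; first by rewrite (@EP_fin _ _ _ (fun z => vcut k (F z) ^+ 4)).
  by move=> *; rewrite lee_fin exprn_ge0 ?vcut_ge0.
apply: (le_trans (integral_coord_le iidP dens mh h0)).
apply: ge0_le_integral => //.
- by move=> z _; rewrite lee_fin mulr_ge0.
- by apply/measurable_EFinP; apply: measurable_funM.
- exact: (measurable_int mu iF96).
- move=> z _; rewrite -EFinM lee_fin mulrA ler_wpM2r//.
  exact: sum_vcut4.
Qed.

(** Borel-Cantelli over the blocks, with summable bounds from [sum_LLn] and [sum_blockG]. The factor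
    4 comes from [bscale_le], which passes from the block scale to each [n] in the block. *)
Theorem bounded_lil (F : Z -> R) (f : nat -> Z -> R) (e : nat -> R) (c0 M : R) (n0 : nat) :
  measurable_fun setT (F : ZB -> R) ->
  (forall j, measurable_fun setT (f j : ZB -> R)) ->
  (forall j z, `|f j z| <= F z) -> (forall j, `|e j| <= c0) -> 0 <= M ->
  (forall n, (n0 <= n)%N ->
    Pr P (exc (fun j z => f j z - e j) n (M * Num.sqrt n%:R)) <= 1 / 2048) ->
  L1_dens mu pstar (fun z => phiLL (F z)) ->
  {ae P, forall w, exists N, forall n, (N <= n)%N -> forall j,
    `|psum (fun j z => f j z - e j) n j w| <=
      4 * (16 * M + 7) * Num.sqrt (n%:R * ln (ln n%:R))}.
Proof.
move=> mF mf fF ec M0 tight iF.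
set g := fun j z => f j z - e j in tight *.
have F0 z : 0 <= F z by exact: le_trans (fF 0%N z).
have [C HC] := sum_blockG mF F0 iF.
have v01 k z : 0 <= vcut k (F z) ^+ 4 <= 1.
  by rewrite exprn_ge0 ?vcut_ge0//= exprn_ile1 ?vcut_ge0// vcut_le1.
have G0 k : 0 <= blockG P F k by rewrite mulr_ge0 ?exprn_ge0// EP_ge0.
have eps0 : 0 < (1 / 1024) ^+ 2 :> R by apply: exprn_gt0; lra.
have [K1 HK1] := bounded_sums_small G0 HC eps0.
have [k2 Hk2] : exists k2 : nat, c0 ^+ 2 <= k2%:R.
  by exists (Num.bound (c0 ^+ 2)); rewrite ltW// archi_boundP// sqr_ge0.
have mg := measurable_class e mf.
pose A k := maxexc g (2 ^ k) ((16 * M + 7) * bscale R k).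
have ae := @borel_cantelli R Z P A (fun k => 64^-1 ^+ LLn k + 3 * blockG P F k)
  (2 + 3 * C) (maxn (maxn 4 n0) (maxn K1 k2)).
apply: filterS (ae _ _ _ _).
(* The block of [n] ends at the first power of 2 above [n]; the floor 16 on its exponent is what
   [bscale_le] requires. *)
- move=> w [K HK]; exists (2 ^ (maxn K 16))%N => n Kn j.
  have n0' : (0 < n)%N by apply: leq_trans Kn; rewrite expn_gt0.
  pose k := (trunc_log 2 n).+1.
  have kn : (2 ^ k.-1 <= n)%N by exact: trunc_logP.
  have nk : (n <= 2 ^ k)%N by rewrite ltnW// trunc_log_ltn.
  have Kk : (maxn K 16 <= k)%N.
    by rewrite -(@leq_exp2l 2)// (leq_trans Kn).
  have [Kk1 Kk2] : (K <= k)%N /\ (16 <= k)%N by move: Kk; rewrite geq_max => /andP[].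
  apply: (@le_trans _ _ ((16 * M + 7) * bscale R k)).
    rewrite leNgt; apply/negP => H; apply: (HK k Kk1).
    by exists n => //; exists j.
  have C0 : 0 <= 16 * M + 7 by lra.
  rewrite (mulrC 4) -mulrA ler_wpM2l//; exact: bscale_le.
- by move=> k; apply: measurable_maxexc.
- by move=> k; apply: addr_ge0; [rewrite exprn_ge0|rewrite mulr_ge0].
- move=> K; rewrite big_split /= -mulr_sumr lerD ?sum_LLn// ler_pM2l//; exact: HC.
- move=> k; rewrite !geq_max => /andP[/andP[k4 kn0] /andP[kK1 kk2]].
  have c0k : c0 ^+ 2 <= k%:R by rewrite (le_trans Hk2)// ler_nat.
  exact: (block_bound iidP dens mF mf fF ec M0 tight k4 kn0 c0k (HK1 k kK1)).
Qed.

End BoundedLIL.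

(** * From the Donsker property to boundedness in probability *)

Section DonskerTightness.
Context (R : realType) (Z : ptopologicalType).
Local Notation ZB := (Borel Z).
Context (mu : {measure set ZB -> \bar R}) (pstar : ZB -> R) (P : probability (Seq Z) R).
Variable F : set (Z -> R).

Definition supnorm (x : (Z -> R) -> R) : R := supdist F x (fun=> 0).

Lemma supdist_has_ub x y : linf F x -> linf F y ->
  has_ubound [set `|x f - y f| | f in F].
Proof.
move=> [A HA] [B HB]; exists (A + B) => _ [f Ff <-].
by rewrite (le_trans (ler_normB _ _))// lerD ?HA ?HB.
Qed.

Lemma linf0 : linf F (fun=> 0).
Proof. by exists 0 => f _; rewrite normr0. Qed.

Lemma le_supdist x y f : linf F x -> linf F y -> F f -> `|x f - y f| <= supdist F x y.
Proof. by move=> lx ly Ff; apply: ub_le_sup; [exact: supdist_has_ub|exists f]. Qed.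

Lemma supdist_le x y c : 0 <= c -> (forall f, F f -> `|x f - y f| <= c) ->
  supdist F x y <= c.
Proof.
move=> c0 H; rewrite /supdist.
have [[r Hr]|] := pselect ([set `|x f - y f| | f in F] !=set0).
  by apply: ge_sup; [exists r|move=> _ [f Ff <-]; exact: H].
(* For an empty class the supremum takes its default value 0. *)
by move=> /set0P/negP/negPn/eqP ->; rewrite sup0.
Qed.

Lemma supdist_ge0 x y : linf F x -> linf F y -> 0 <= supdist F x y.
Proof.
move=> lx ly; have [[f Ff]|] := pselect (F !=set0).
  exact: le_trans (le_supdist lx ly Ff).
by move=> /set0P/negP/negPn/eqP F0; rewrite /supdist F0 image_set0 sup0.
Qed.

Lemma supnorm_triangle x y : linf F x -> linf F y ->
  supnorm y <= supnorm x + supdist F x y.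
Proof.
move=> lx ly; apply: supdist_le.
  by rewrite addr_ge0// supdist_ge0//; exact: linf0.
move=> f Ff; rewrite (_ : y f - 0 = (x f - 0) - (x f - y f)); last by ring.
rewrite (le_trans (ler_normB _ _))// lerD ?le_supdist//; exact: linf0.
Qed.

Lemma supdistC x y : supdist F x y = supdist F y x.
Proof. by rewrite /supdist; congr (sup (image _ _)); apply/funext => f; rewrite distrC. Qed.

(* A continuous surrogate of the indicator of [supnorm x > M]. *)
Definition ramp (M : R) (x : (Z -> R) -> R) : R :=
  Num.min 1 (Num.max 0 (supnorm x - M)).

Lemma ramp01 M x : 0 <= ramp M x <= 1.
Proof. by rewrite /ramp le_min ler01 le_max lexx /= ge_min lexx. Qed.

Lemma ramp_lip M x y : linf F x -> linf F y -> `|ramp M y - ramp M x| <= supdist F x y.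
Proof.
move=> lx ly.
have H1 := supnorm_triangle lx ly.
have H2 := supnorm_triangle ly lx; rewrite supdistC in H2.
have H0 := supdist_ge0 lx ly.
move: H0 H1 H2; rewrite /ramp; move: (supnorm x) (supnorm y) (supdist F x y) => a b d H0 H1 H2.
have mx s t : s <= t + d -> Num.max 0 s <= Num.max 0 t + d.
  move=> st; rewrite ge_max; apply/andP; split.
    by rewrite addr_ge0// le_max lexx.
  by rewrite (le_trans st)// lerD2r le_max lexx orbT.
have mn s t : s <= t + d -> Num.min 1 s <= Num.min 1 t + d.
  move=> st; rewrite -lerBlDr le_min !lerBlDr; apply/andP; split.
    by rewrite ge_min lerDl H0.
  by rewrite ge_min st orbT.
rewrite ler_distl; apply/andP; split.
  by rewrite lerBlDr; apply/mn/mx; lra.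
by apply/mn/mx; lra.
Qed.

Lemma ramp_bcont M : linf_bcont F (ramp M).
Proof.
split.
  by exists 1 => x _; have /andP[? ?] := ramp01 M x; rewrite ger0_norm.
move=> x lx e e0; exists e => // y ly xy.
exact: le_lt_trans (ramp_lip M lx ly) xy.
Qed.

Lemma supnorm_open c : linf_open F [set x | linf F x /\ supnorm x < c].
Proof.
split; first by move=> x [].
move=> x [lx xc]; exists (c - supnorm x); first by rewrite subr_gt0.
move=> y ly xy; split => //.
by rewrite (le_lt_trans (supnorm_triangle lx ly))// addrC -ltrBrDr.
Qed.

(** Weak convergence is tested on [ramp], whose limit expectation is small because the Gaussian
    limit has finite norm. Quantifying over measurable [A] avoids measurability of the norm of the
    empirical process. *)
Lemma donsker_tight (eps : R) : 0 < eps -> donsker mu F pstar P ->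
  exists M n0, [/\ 0 <= M, forall n w, linf F (emp_proc mu pstar n w) &
   forall n (A : set (Seq Z)), (n0 <= n)%N -> measurable A ->
    (forall w, A w -> M < supnorm (emp_proc mu pstar n w)) -> Pr P A <= eps].
Proof.
move=> e0 [lemp [dd [Om [PO [G [lG mG _ _ wG]]]]]].
have mN c : measurable [set o | supnorm (G o) < c].
  have := mG _ (supnorm_open c).
  by rewrite (_ : G @^-1` _ = [set o | supnorm (G o) < c])//; apply/seteqP; split => o /= ; [case|split].
(* These events decrease to the empty set, since every path of [G] is bounded. *)
pose D n := ~` [set o | supnorm (G o) < n%:R].
have mD n : measurable (D n) by apply: measurableC; exact: mN.
have [M HM] : exists M : nat, (PO (D M) < (eps / 2)%:E)%E.
  have : PO (D n) @[n --> \oo] --> PO (\bigcap_n D n).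
    apply: nonincreasing_cvg_mu => //.
    - by rewrite (le_lt_trans (probability_le1 PO (mD _)))// ltry.
    - exact: bigcapT_measurable.
    - move=> n m nm; apply/subsetPset => o /= /negP; rewrite -leNgt => H.
      by apply/negP; rewrite -leNgt (le_trans _ H)// ler_nat.
  rewrite (_ : \bigcap_n D n = set0); last first.
    apply/seteqP; split => // o H.
    have := H (Num.bound (supnorm (G o))) I; apply => /=.
    by rewrite archi_boundP// supdist_ge0//; exact: linf0.
  rewrite measure0 => /fine_cvgP[_ /cvgrPdist_lt/(_ (eps / 2))].
  move=> /(_ ltac:(by rewrite divr_gt0))[M _ HM].
  exists M; have := HM M (leqnn M); rewrite sub0r normrN /= => H.
  rewrite -(@fineK _ (PO (D M))) ?fin_num_measure// lte_fin.
  exact: le_lt_trans (ler_norm _) H.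
have mramp : measurable_fun setT (fun o => (ramp M%:R (G o))%:E).
  apply/measurable_EFinP; apply: measurable_minr => //; apply: measurable_maxr => //.
  apply: measurable_funB => //.
  apply: (measurability _ (RGenInftyO.measurableE R)) => //.
  move=> _ [_ [c ->] <-]; rewrite setTI.
  rewrite [X in measurable X](_ : _ = [set o | supnorm (G o) < c]); first exact: mN.
  by apply/seteqP; split => o /=; rewrite in_itv.
have IG : (\int[PO]_o (ramp M%:R (G o))%:E < (eps / 2)%:E)%E.
  apply: le_lt_trans HM.
  rewrite -[X in (_ <= PO X)%E]setIT -integral_indic//.
  apply: ge0_le_integral => //.
  - by move=> o _; rewrite lee_fin; case/andP: (ramp01 M%:R (G o)).
  - by apply/measurable_EFinP.
  - move=> o _; rewrite lee_fin indicE.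
    have [_|oD] := boolP (o \in D M); first by case/andP: (ramp01 M%:R (G o)).
    have Do : supnorm (G o) < M%:R.
      by apply: contrapT => nDo; move/negP: oD; apply; rewrite inE.
    rewrite /ramp (_ : Num.max _ _ = 0) ?ge_min ?lexx ?orbT//.
    by apply/max_idPl; rewrite subr_le0 ltW.
have wM := wG _ (ramp_bcont M%:R).
have [n0 _ Hn0] : \forall n \near \oo,
    (outer_E P (fun w => ramp M%:R (emp_proc mu pstar n w)) < eps%:E)%E.
  have IGe : (\int[PO]_o (ramp M%:R (G o))%:E < eps%:E)%E.
    by apply: (lt_le_trans IG); rewrite lee_fin; lra.
  exact: (wM _ (open_ereal_lt' IGe)).
(* Beyond [M + 1] the ramp equals 1, so every majorant of the ramp dominates the indicator of
   [A]. *)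
exists (M%:R + 1), n0; split => // n A n0n mA HA.
have := Hn0 n n0n; rewrite /outer_E => /ereal_inf_lt[_ [U [mU iU UH] <-]] HU.
rewrite -lee_fin -PrE//; apply: le_trans (ltW HU).
rewrite -[X in P X]setIT -integral_indic//; apply: ge0_le_integral => //.
- by apply/measurable_EFinP.
- by apply/measurable_EFinP.
- move=> w _; rewrite lee_fin; apply: le_trans (UH w).
  rewrite indicE; have [/[!inE] /HA Aw|_] := boolP (w \in A); last first.
    by case/andP: (ramp01 M%:R (emp_proc mu pstar n w)).
  rewrite /ramp le_min lexx /= le_max; apply/orP; right; lra.
Qed.

End DonskerTightness.

(** * Log-likelihood ratios and Kullback-Leibler divergence *)

Lemma ln_le_sub1 (R : realType) (x : R) : 0 < x -> ln x <= x - 1.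
Proof.
move=> x0; have := @le_ln1Dx R (x - 1).
by rewrite [1 + (x - 1)]addrC subrK; apply; lra.
Qed.

Lemma is_density_integrable (R : realType) (Z : ptopologicalType)
  (mu : {measure set (Borel Z) -> \bar R}) (q : Borel Z -> R) :
  is_density mu q -> mu.-integrable setT (EFin \o q).
Proof.
move=> [mq q0 q1]; apply/integrableP; split; first exact/measurable_EFinP.
rewrite (eq_integral (EFin \o q)) ?q1 ?ltry// => z _ /=.
by rewrite ger0_norm.
Qed.

Section Divergence.
Context (R : realType) (Z : ptopologicalType).
Local Notation ZB := (Borel Z).
Context (mu : {measure set ZB -> \bar R}).
Variables (pstar : ZB -> R) (l u : ZB -> R).
Hypothesis dens : is_density mu pstar.
Hypothesis iul : L1_dens mu pstar (fun z => u z - l z).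
Hypothesis star_ul : forall z, 0 < pstar z /\ l z <= ln (pstar z) <= u z.

Definition llr (q : ZB -> R) (z : Z) : R := ln (q z) - ln (pstar z).

Definition admissible (q : ZB -> R) : Prop :=
  is_density mu q /\ forall z, 0 < q z /\ l z <= ln (q z) <= u z.

(** Integrability makes the product of [u - l] and [pstar] measurable, and the positive factor
    [pstar] is divided out through [expR (- ln pstar)]. *)
Lemma measurable_ul : measurable_fun setT ((fun z => u z - l z) : ZB -> R).
Proof.
have [mp p0 _] := dens.
have mi : measurable_fun setT ((fun z => expR (- ln (pstar z))) : ZB -> R).
  apply: measurableT_comp => //; apply: measurableT_comp => //.
  by apply: measurableT_comp => //; exact: measurable_ln.
have mup : measurable_fun setT ((fun z => (u z - l z) * pstar z) : ZB -> R).
  by move/integrableP: iul => [/measurable_EFinP].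
rewrite (_ : (fun z => u z - l z) =
   (fun z => (u z - l z) * pstar z * expR (- ln (pstar z)))).
  exact: measurable_funM.
apply/funext => z; have [pz _] := star_ul z.
by rewrite expRN lnK ?posrE// mulfK// gt_eqF.
Qed.

Section Model.
Variable q : ZB -> R.
Hypothesis adm : admissible q.

Lemma measurable_llr : measurable_fun setT (llr q : ZB -> R).
Proof.
have [mp _ _] := dens; have [[mq _ _] _] := adm.
by apply: measurable_funB; apply: measurableT_comp => //; exact: measurable_ln.
Qed.

Lemma llr_le z : `|llr q z| <= u z - l z.
Proof.
have [_ /andP[l1 u1]] := star_ul z; have [_ /(_ z)[_ /andP[l2 u2]]] := adm.
by rewrite /llr ler_norml; apply/andP; split; lra.
Qed.

Lemma measurable_llrp : measurable_fun setT (fun z : ZB => (llr q z * pstar z)%:E).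
Proof.
have [mp _ _] := dens.
by apply/measurable_EFinP; apply: measurable_funM => //; exact: measurable_llr.
Qed.

Lemma integrable_llr : mu.-integrable setT (fun z : ZB => (llr q z * pstar z)%:E).
Proof.
have [mp p0 _] := dens.
apply: le_integrable iul => //; first exact: measurable_llrp.
move=> z _ /=; rewrite lee_fin !normrM ler_wpM2r//.
rewrite [leRHS]ger0_norm ?llr_le//.
exact: le_trans (llr_le z).
Qed.

Lemma EdensE : ((Edens mu pstar (llr q))%:E = \int[mu]_z (llr q z * pstar z)%:E)%E.
Proof. by rewrite /Edens fineK// integrable_fin_num// integrable_llr. Qed.

Lemma Edens_llr_bound : `|Edens mu pstar (llr q)| <= Edens mu pstar (fun z => u z - l z).
Proof.
have [mp p0 _] := dens.
have H : (`|\int[mu]_z (llr q z * pstar z)%:E| <= \int[mu]_z ((u z - l z) * pstar z)%:E)%E.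
  apply: (le_trans (le_abse_integral _ measurableT measurable_llrp)).
  apply: ge0_le_integral => //.
  - by apply: measurableT_comp => //; exact: measurable_llrp.
  - exact: (measurable_int mu iul).
  - by move=> z _; rewrite lee_fin normrM (ger0_norm (p0 z)) ler_wpM2r ?llr_le.
rewrite -lee_fin -abse_EFin EdensE (le_trans H)// /Edens fineK// integrable_fin_num//.
Qed.

Lemma integrable_density : mu.-integrable setT (fun z : ZB => (q z - pstar z)%:E).
Proof.
have [mp p0 p1] := dens; have [[mq q0 q1] _] := adm.
rewrite (_ : (fun z => _) = ((EFin \o q) \- (EFin \o pstar))%E); last exact/funext.
by apply: integrableB => //; apply: is_density_integrable => //; case: adm.
Qed.

Lemma integral_density0 : (\int[mu]_z (q z - pstar z)%:E = 0)%E.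
Proof.
have [mp p0 p1] := dens; have [[mq q0 q1] _] := adm.
under eq_integral do rewrite EFinB.
rewrite integralB//; [|by apply: is_density_integrable; case: adm|exact: is_density_integrable].
by rewrite q1 p1 subee.
Qed.

(* The Gibbs gap: nonnegative because ln t <= t - 1. *)
Definition gap (z : Z) : R := (q z - pstar z) - llr q z * pstar z.

Lemma llr_ratio z : llr q z = ln (q z / pstar z).
Proof.
have [pz _] := star_ul z; have [_ /(_ z)[qz _]] := adm.
by rewrite /llr ln_div.
Qed.

Lemma gap_ge0 z : 0 <= gap z.
Proof.
have [pz _] := star_ul z; have [_ /(_ z)[qz _]] := adm.
have t0 : 0 < q z / pstar z by rewrite divr_gt0.
have : ln (q z / pstar z) <= q z / pstar z - 1.
  exact: ln_le_sub1.
rewrite /gap llr_ratio => /(ler_wpM2r (ltW pz)).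
by rewrite mulrBl divfK ?gt_eqF// mul1r; lra.
Qed.

(* Equality in ln t <= t - 1 forces t = 1, since ln t = 2 ln (sqrt t) <= 2 (sqrt t - 1). *)
Lemma gap_eq0 z : gap z = 0 -> q z = pstar z.
Proof.
have [pz _] := star_ul z; have [_ /(_ z)[qz _]] := adm.
rewrite /gap llr_ratio; set t := q z / pstar z => H.
have t0 : 0 < t by rewrite divr_gt0.
have qE : q z = t * pstar z by rewrite divfK// gt_eqF.
pose s := Num.sqrt t; have s0 : 0 < s by rewrite sqrtr_gt0.
have tE : t = s ^+ 2 by rewrite sqr_sqrtr// ltW.
have lns : ln s <= s - 1 by exact: ln_le_sub1.
have lnt : ln t = 2 * ln s by rewrite tE lnXn// mulr_natl.
have H' : (t - 1) * pstar z = ln t * pstar z by rewrite mulrBl mul1r -qE; lra.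
have {}H' : t - 1 = ln t by apply: (mulIf _ H'); rewrite gt_eqF.
have s1 : s = 1 by nra.
by rewrite qE tE s1 expr1n mul1r.
Qed.

(** Both densities integrate to 1, so only the logarithmic part of the gap survives. *)
Lemma integral_gap : (\int[mu]_z (gap z)%:E = - \int[mu]_z (llr q z * pstar z)%:E)%E.
Proof.
rewrite (eq_integral (fun z => (q z - pstar z)%:E - (llr q z * pstar z)%:E)%E)//.
rewrite integralB//; [|exact: integrable_density|exact: integrable_llr].
by rewrite integral_density0 sub0e.
Qed.

Lemma Edens_llr_le0 : Edens mu pstar (llr q) <= 0.
Proof.
rewrite -lee_fin EdensE -leeN2 oppe0 -integral_gap integral_ge0// => z _.
by rewrite lee_fin gap_ge0.
Qed.

(** The nonnegative gap then has integral zero, so it vanishes almost everywhere, and [gap_eq0]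
    identifies the densities. *)
Lemma Edens_llr_ge0_same_law : 0 <= Edens mu pstar (llr q) -> same_law mu pstar q.
Proof.
move=> E0; have [mp p0 _] := dens; have [[mq q0 _] _] := adm.
have mgap : measurable_fun setT (fun z : ZB => (gap z)%:E).
  apply/measurable_EFinP; apply: measurable_funB; first exact: measurable_funB.
  by apply: measurable_funM => //; exact: measurable_llr.
have I0 : (\int[mu]_z `|(gap z)%:E| = 0)%E.
  under eq_integral do rewrite gee0_abs ?lee_fin ?gap_ge0//.
  apply/eqP; rewrite eq_le; apply/andP; split.
    by rewrite integral_gap -EdensE leeNl oppe0 lee_fin.
  by apply: integral_ge0 => z _; rewrite lee_fin gap_ge0.
have ae0 : ae_eq mu setT (fun z : ZB => (gap z)%:E) (cst 0%E).
  exact/ae_eq_integral_abs.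
move=> A mA; rewrite /dmeas; apply: ge0_ae_eq_integral => //.
- by apply: measurable_funTS; exact/measurable_EFinP.
- by apply: measurable_funTS; exact/measurable_EFinP.
- by move=> z _; rewrite lee_fin.
- by move=> z _; rewrite lee_fin.
- apply: filterS ae0 => z /(_ I) [] /gap_eq0 -> //.
Qed.

Lemma same_law_Edens_llr : same_law mu pstar q -> Edens mu pstar (llr q) = 0.
Proof.
move=> sl; have [mp p0 p1] := dens; have [[mq q0 _] _] := adm.
have ip : mu.-integrable setT (EFin \o pstar) by exact: is_density_integrable.
have ae : ae_eq mu setT (EFin \o pstar) (EFin \o q).
  apply: integral_ae_eq => //; first exact/measurable_EFinP.
  by move=> A _ mA; exact: sl.
rewrite /Edens (@ae_eq_integral _ _ _ mu setT (cst 0%E))//.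
- by rewrite integral0.
- exact: measurable_llrp.
- by apply: filterS ae => z /(_ I) [] pq _; rewrite /llr -pq subrr mul0r.
Qed.

(** All densities are positive everywhere, so the finite branch of [KL] applies with the whole space
    as domain. *)
Lemma KL_llr : KL mu pstar q = (- Edens mu pstar (llr q))%:E.
Proof.
have pos z : 0 < pstar z by case: (star_ul z).
have qpos z : 0 < q z by have [_ /(_ z)[]] := adm.
rewrite /KL (_ : [set z | _ /\ _] = set0); last first.
  by apply/seteqP; split => // z [_]; rewrite leNgt qpos.
rewrite measure0 eqxx (_ : [set z | 0 < pstar z] = setT); last first.
  by apply/seteqP; split => // z _; exact: pos.
rewrite EFinN EdensE -integralN; last first.
  by apply: fin_num_adde_defl; rewrite fin_numN integrable_neg_fin_num// integrable_llr.
apply: eq_integral => z _; rewrite -EFinN; congr EFin.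
by rewrite llr_ratio mulrC -mulNr -lnV ?posrE ?divr_gt0// invf_div.
Qed.

End Model.
End Divergence.

(** * Sequential arguments in compact metric spaces *)

Lemma cvg_sumr (R : realType) n (f : nat -> nat -> R) (a : nat -> R) :
  (forall i, f i m @[m --> \oo] --> a i) ->
  \sum_(i < n) f i m @[m --> \oo] --> \sum_(i < n) a i.
Proof.
move=> fa; elim: n => [|n IH].
  by under eq_fun do rewrite big_ord0; rewrite big_ord0; exact: cvg_cst.
under eq_fun do rewrite big_ord_recr; rewrite big_ord_recr /=.
exact: cvgD.
Qed.

Section CompactSequences.
Context (R : realType) (T : metricType R).
Implicit Types (A : set T) (x : T) (s : nat -> T).

Lemma within_continuous_seq A (f : T -> R) s x : {within A, continuous f} ->
  A x -> (forall m, A (s m)) -> (forall m, ball x m.+1%:R^-1 (s m)) ->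
  f (s m) @[m --> \oo] --> f x.
Proof.
move=> cf Ax As sx.
have /subspace_continuousP/(_ x Ax) cfx := cf.
move=> U /cfx; rewrite /nbhs /= /nbhs /= => /nbhs_ballP[e e0 He].
have [N HN] : exists N : nat, e^-1 < N%:R.
  by exists (Num.bound e^-1); rewrite archi_boundP// invr_ge0 ltW.
exists N => // m /= Nm; apply: He (As m).
apply: le_ball (sx m); rewrite invf_ple ?posrE//.
by rewrite (le_trans (ltW HN))// ler_nat (leq_trans Nm).
Qed.

(** Picks indices near a cluster point. They need not increase; [m <= k m] and the explicit rate
    replace monotonicity. *)
Lemma compact_subseq A s : compact A -> (forall m, A (s m)) ->
  exists x (k : nat -> nat), [/\ A x, forall m, (m <= k m)%N &
    forall m, ball x m.+1%:R^-1 (s (k m))].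
Proof.
move=> cA As.
have [x [Ax cl]] : A `&` cluster (s @ \oo) !=set0.
  by apply: cA; exists 0%N => // m _; exact: As.
have ex (m : nat) : exists k, (m <= k)%N /\ ball x m.+1%:R^-1 (s k).
  have [] := cl [set y | exists2 k, (m <= k)%N & y = s k] (ball x m.+1%:R^-1).
  - by exists m => // k /= mk; exists k.
  - exact: nbhsx_ballx.
  - by move=> _ [[k mk ->] bk]; exists k.
have [k Hk] := choice ex.
by exists x, k; split => // m; case: (Hk m).
Qed.

(** Without a finite net, greedy choice builds an infinite [e]-separated sequence, which contradicts
    [compact_subseq]. *)
Lemma compact_finite_net A (e : R) : compact A -> 0 < e ->
  exists D : seq T, (forall y, y \in D -> A y) /\
    forall x, A x -> exists2 y, y \in D & ball y e x.
Proof.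
move=> cA e0; apply: contrapT => nD.
have ex (D : seq T) : exists y, (forall d, d \in D -> A d) ->
    A y /\ forall d, d \in D -> ~ ball d e y.
  have [HD|nA] := pselect (forall d, d \in D -> A d); last first.
    have [[y _]|A0] := pselect (A !=set0); first by exists y => /nA.
    by exfalso; apply: nD; exists [::]; split => // x Ax; exfalso; apply: A0; exists x.
  apply: contrapT => H; apply: nD; exists D; split => // x Ax.
  apply: contrapT => H'; apply: H; exists x => _; split => // d dD dx.
  by apply: H'; exists d.
have [g Hg] := choice ex.
pose L := fix L n := if n is n'.+1 then g (L n') :: L n' else [::].
have LA n : forall d, d \in L n -> A d.
  elim: n => // n IH d; rewrite /= inE => /predU1P[->|]; last exact: IH.
  by case: (Hg _ IH).
pose s n := g (L n).
have As n : A (s n) by case: (Hg _ (LA n)).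
have sL i j : (i < j)%N -> s i \in L j.
  elim: j => // j IH; rewrite ltnS leq_eqVlt => /predU1P[->|/IH ij] /=.
    by rewrite mem_head.
  by rewrite inE ij orbT.
have far i j : (i < j)%N -> ~ ball (s i) e (s j).
  by move=> ij; have [_] := Hg _ (LA j); apply; exact: sL.
have [x [k [Ax mk xk]]] := compact_subseq cA As.
have [N HN] : exists N : nat, (e / 2)^-1 < N%:R.
  by exists (Num.bound (e / 2)^-1); rewrite archi_boundP// invr_ge0 divr_ge0// ltW.
have small m : (N <= m)%N -> ball x (e / 2) (s (k m)).
  move=> Nm; apply: le_ball (xk m); rewrite invf_ple ?posrE ?divr_gt0//.
  by rewrite (le_trans (ltW HN))// ler_nat (leq_trans Nm).
(* Two distinct chosen points lie within [e / 2] of the cluster point, hence within [e] of each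
   other. *)
have kN : (k N < k (k N).+1)%N by exact: mk.
apply: (far _ _ kN); rewrite [e]splitr; apply: ball_triangle (small (k N).+1 _).
  by apply: ball_sym; exact: small.
by rewrite (leq_trans (mk N)).
Qed.

(** Enumerates the finite nets of radius [m.+1%:R^-1] through coded pairs; codes that point nowhere
    default to [x0]. *)
Lemma compact_dense_seq A x0 : compact A -> A x0 ->
  exists s : nat -> T, (forall j, A (s j)) /\
    forall x, A x -> forall e, 0 < e -> exists j, ball x e (s j).
Proof.
move=> cA Ax0.
have cov (m : nat) : exists D : seq T, (forall y, y \in D -> A y) /\
    forall x, A x -> exists2 y, y \in D & ball y m.+1%:R^-1 x.
  exact: compact_finite_net.
have [D HD] := choice cov.
pose s (j : nat) : T := if @unpickle (nat * nat)%type j is Some (m, i)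
  then nth x0 (D m) i else x0.
exists s; split.
  move=> j; rewrite /s; case: unpickle => [[m i]|//].
  have [im|im] := ltnP i (size (D m)); last by rewrite nth_default.
  by apply: (HD m).1; exact: mem_nth.
move=> x Ax e e0.
have [N HN] : exists N : nat, e^-1 < N%:R.
  by exists (Num.bound e^-1); rewrite archi_boundP// invr_ge0 ltW.
have [y yD yx] := (HD N).2 x Ax.
exists (pickle (N, index y (D N))); rewrite /s pickleK nth_index//.
apply: ball_sym; apply: le_ball yx; rewrite invf_ple ?posrE//.
by rewrite (le_trans (ltW HN))// ler_nat.
Qed.

End CompactSequences.

(** * The law of the iterated logarithm uniformly over a compact model *)

Section UniformLIL.
Context (R : realType) (Z : ptopologicalType).
Local Notation ZB := (Borel Z).
Context (mu : {measure set ZB -> \bar R}) (P : probability (Seq Z) R).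
Context (Theta : metricType R) (A : set Theta) (p : Theta -> ZB -> R).
Variables (pstar : ZB -> R) (l u : ZB -> R).
Hypothesis iidP : iid_law mu pstar P.
Hypothesis dens : is_density mu pstar.
Hypothesis iul : L1_dens mu pstar (fun z => u z - l z).
Hypothesis star_ul : forall z, 0 < pstar z /\ l z <= ln (pstar z) <= u z.
Hypothesis admA : forall th, A th -> admissible mu l u (p th).
Hypothesis cA : compact A.
Hypothesis contA : forall z, {within A, continuous (fun th => ln (p th z))}.

Definition Ellr (th : Theta) : R := Edens mu pstar (llr pstar (p th)).

(** Dominated convergence with the envelope [u - l]. *)
Lemma Ellr_seq (s : nat -> Theta) x : A x -> (forall m, A (s m)) ->
  (forall m, ball x m.+1%:R^-1 (s m)) -> Ellr (s m) @[m --> \oo] --> Ellr x.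
Proof.
move=> Ax As sx; have [mp p0 _] := dens.
have ae1 : {ae mu, forall z, setT z ->
    (fun m => (llr pstar (p (s m)) z * pstar z)%:E) @ \oo -->
    (llr pstar (p x) z * pstar z)%:E}.
  apply: aeW => z _; apply/fine_cvgP; split; first exact: nearW.
  have c1 := within_continuous_seq (@contA z) Ax As sx.
  exact: (cvgM (cvgB c1 (cvg_cst (ln (pstar z)))) (cvg_cst (pstar z))).
have ae2 : {ae mu, forall z m, setT z ->
    (`|(llr pstar (p (s m)) z * pstar z)%:E| <= ((u z - l z) * pstar z)%:E)%E}.
  apply: aeW => z m _; rewrite lee_fin normrM (ger0_norm (p0 z)) ler_wpM2r//.
  exact: (llr_le star_ul (admA (As m))).
have [_ _ cvgI] := dominated_convergence measurableT
  (fun m => measurable_llrp dens (admA (As m)))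
  (measurable_llrp dens (admA Ax)) ae1 iul ae2.
have /fine_cvgP[_] : ((Ellr (s m))%:E @[m --> \oo] --> (Ellr x)%:E)%E.
  rewrite /Ellr (EdensE dens iul star_ul (admA Ax)).
  by under eq_fun do rewrite (EdensE dens iul star_ul (admA (As _))).
exact.
Qed.

(** Otherwise parameters whose divergence tends to 0 accumulate at a point of [A] with zero
    divergence, which has the law of [pstar]. *)
Lemma Ellr_gap : ~ (exists2 th, A th & same_law mu pstar (p th)) ->
  exists2 eta, 0 < eta & forall th, A th -> Ellr th + eta <= 0.
Proof.
move=> nsl; apply: contrapT => nex; apply: nsl.
have ex (m : nat) : exists th, A th /\ - m.+1%:R^-1 <= Ellr th.
  apply: contrapT => H; apply: nex; exists m.+1%:R^-1 => // th Ath.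
  rewrite leNgt; apply/negP => H'; apply: H; exists th; split => //.
  by rewrite -subr_ge0 opprK ltW.
have [s Hs] := choice ex.
have [x [k [Ax mk xk]]] := compact_subseq cA (fun m => (Hs m).1).
exists x => //; apply: (Edens_llr_ge0_same_law dens iul star_ul (admA Ax)).
have cE := Ellr_seq Ax (fun m => (Hs (k m)).1) xk.
have c0 : - m.+1%:R^-1 @[m --> \oo] --> (- 0 : R).
  by apply: cvgN; exact: cvg_harmonic.
rewrite -/(Ellr x) -[0]oppr0; apply: (ler_cvg_to c0 cE); apply: nearW => m.
apply: le_trans (Hs (k m)).2; rewrite lerN2 lef_pV2 ?posrE//.
by rewrite ler_nat ltnS.
Qed.

(** Applies [bounded_lil] along a dense sequence of parameters; for fixed [n] and [w] both terms are
    sequentially continuous in the parameter, so the bound passes to all of [A]. *)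
Lemma uniform_lil : A !=set0 -> L1_dens mu pstar (fun z => phiLL (u z - l z)) ->
  donsker mu [set llr pstar (p th) | th in A] pstar P ->
  exists2 C : R, 0 <= C & {ae P, forall w : Seq Z, exists N, forall n, (N <= n)%N ->
    forall th, A th ->
    `|\sum_(i < n) llr pstar (p th) (w i) - n%:R * Ellr th| <=
      C * Num.sqrt (n%:R * ln (ln n%:R))}.
Proof.
move=> [x0 Ax0] iphi don.
have [s [As ds]] := compact_dense_seq cA Ax0.
have eps0 : 0 < 1 / 2048 :> R by lra.
have [M [n0 [M0 lemp tight]]] := donsker_tight eps0 don.
pose f j := llr pstar (p (s j)).
pose e j := Ellr (s j).
pose g j z := f j z - e j.
have psumE n j w : psum g n j w = \sum_(i < n) f j (w i) - n%:R * e j.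
  by rewrite /psum /g sumrB sumr_const card_ord mulr_natl.
have mf j : measurable_fun setT (f j : ZB -> R) := measurable_llr dens (admA (As j)).
have mg := measurable_class e mf.
have tight' n : (n0 <= n)%N -> Pr P (exc g n (M * Num.sqrt n%:R)) <= 1 / 2048.
  move=> nn; apply: (tight n _ nn); first exact: measurable_exc.
  move=> w [j Hj].
  (* For [n = 0] both sides are 0 and the strict exceedance is impossible; the rescaling below
     divides by [n]. *)
  case: n {nn} Hj => [|n] Hj.
    by exfalso; move: Hj; rewrite psum0 normr0 sqrtr0 mulr0 ltxx.
  have sn : 0 < Num.sqrt n.+1%:R :> R by rewrite sqrtr_gt0.
  have nn : n.+1%:R = Num.sqrt n.+1%:R ^+ 2 :> R by rewrite sqr_sqrtr.
  have H : psum g n.+1 j w = Num.sqrt n.+1%:R * emp_proc mu pstar n.+1 w (f j).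
    rewrite psumE /emp_proc -/(e j) mulrA -expr2 -nn mulrBr mulrA.
    by rewrite divff ?mul1r// pnatr_eq0.
  move: Hj; rewrite H normrM gtr0_norm// mulrC ltr_pM2l// => /lt_le_trans; apply.
  rewrite -[emp_proc _ _ _ _ _]subr0; apply: le_supdist => //.
  - exact: linf0.
  - by exists (s j).
exists (4 * (16 * M + 7)); first by rewrite mulr_ge0// addr_ge0// mulr_ge0.
have lil := bounded_lil iidP dens (measurable_ul dens iul star_ul) mf
  (fun j z => llr_le star_ul (admA (As j)) z)
  (fun j => Edens_llr_bound dens iul star_ul (admA (As j))) M0 tight' iphi.
apply: filterS lil => w [N HN]; exists N => n Nn th Ath.
have ex (m : nat) : exists j, ball th m.+1%:R^-1 (s j) by apply: ds.
have [k Hk] := choice ex.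
have cS : \sum_(i < n) llr pstar (p (s (k m))) (w i) @[m --> \oo] -->
    \sum_(i < n) llr pstar (p th) (w i).
  apply: (cvg_sumr (f := fun i m => llr pstar (p (s (k m))) (w i))
    (a := fun i => llr pstar (p th) (w i))) => i.
  have c1 := within_continuous_seq (@contA (w i)) Ath (fun m => As (k m)) Hk.
  exact: (cvgB c1 (cvg_cst (ln (pstar (w i))))).
have cE : n%:R * Ellr (s (k m)) @[m --> \oo] --> n%:R * Ellr th.
  exact: (cvgM (cvg_cst (n%:R : R)) (Ellr_seq Ath (fun m => As (k m)) Hk)).
have cN : `|\sum_(i < n) llr pstar (p (s (k m))) (w i) - n%:R * Ellr (s (k m))|
    @[m --> \oo] --> `|\sum_(i < n) llr pstar (p th) (w i) - n%:R * Ellr th|.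
  by apply: cvg_norm; exact: cvgB.
rewrite -(cvg_lim _ cN)//; apply: limr_le; first exact: cvgP cN.
apply: nearW => m /=; rewrite -[X in `|X|]psumE.
exact: HN.
Qed.

End UniformLIL.

(** * Quantitative forms of the penalty conditions *)

Section Penalty.
Context (R : realType).
Variable (pen : nat -> nat -> R).
Hypothesis pen_gt0 : forall n K, (1 <= K)%N -> 0 < pen n K.

Lemma pen_ratio K : (1 <= K)%N ->
  (1 < limn_einf (fun n => (pen n K.+1 / pen n K)%:E))%E ->
  exists2 eps : R, 0 < eps & exists N, forall n, (N <= n)%N ->
    (1 + eps) * pen n K <= pen n K.+1.
Proof.
move=> K1; set v := fun n => _; rewrite limn_einf_lim => Hlim.
have cv : einfs v @ \oo --> limn (einfs v) by exact: is_cvg_einfs.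
have [N _ HN] := cv _ (open_ereal_gt' Hlim).
have {}HN : (1 < einfs v N)%E by exact: HN N (leqnn N).
have le_v n : (N <= n)%N -> (einfs v N <= v n)%E.
  by move=> Nn; apply: ereal_inf_lbound; exists n.
(* The tail infimum minus 1 serves as [eps]; an infinite value contradicts the finiteness of the
   ratio or the lower bound 1. *)
case E : (einfs v N) HN le_v => [r| |] HN le_v.
- exists (r - 1); first by rewrite subr_gt0 -lte_fin.
  exists N => n Nn; have := le_v n Nn; rewrite /v lee_fin ler_pdivlMr ?pen_gt0//.
  by rewrite addrC subrK.
- by have := le_v N (leqnn N).
- by [].
Qed.

(** For a nonnegative sequence, a zero upper limit is convergence to zero. *)
Lemma pen_dominates (r : nat -> R) K : (1 <= K)%N -> (forall n, 0 <= r n) ->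
  limn_esup (fun n => (r n / pen n K)%:E) = 0%E ->
  forall c, 0 < c -> exists N, forall n, (N <= n)%N -> r n <= c * pen n K.
Proof.
move=> K1 r0 Hlim c c0.
have : (fun n => (r n / pen n K)%:E) @ \oo --> 0%E.
  apply: limn_esup_le_cvg; first by rewrite Hlim.
  by move=> n; rewrite lee_fin divr_ge0// ltW// pen_gt0.
move=> cv; have c0E : (0 < c%:E)%E by rewrite lte_fin.
have [N _ HN] := cv _ (open_ereal_lt' c0E).
exists N => n Nn; have := HN n Nn; rewrite /= lte_fin => /ltW.
by rewrite ler_pdivrMr// pen_gt0.
Qed.

Lemma pen_small K : (1 <= K)%N -> (fun n => pen n K / n%:R) @ \oo --> (0 : R) ->
  forall c, 0 < c -> exists N, forall n, (N <= n)%N -> (0 < n)%N ->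
    pen n K <= c * n%:R.
Proof.
move=> K1 cv c c0; move/cvgrPdist_le/(_ c c0) : cv => [N _ HN].
exists N => n Nn n0; have := HN n Nn; rewrite /= sub0r normrN => H.
rewrite -ler_pdivrMr ?ltr0n//; exact: le_trans (ler_norm _) H.
Qed.

End Penalty.

(** * Bounds on the penalized likelihood *)

Section Criterion.
Context (R : realType) (Z : Type) (Theta : Type) (ThetaK : nat -> set Theta).
Variables (p : Theta -> Z -> R) (pen : nat -> nat -> R) (w : nat -> Z).

Lemma crit_le n K (x : R) :
  (forall th, ThetaK K th -> \sum_(i < n) ln (p th (w i)) <= x) ->
  (crit ThetaK p pen w n K <= (x - pen n K)%:E)%E.
Proof.
move=> H; rewrite /crit EFinB leeB// ge_ereal_sup// => _ [th Kth <-].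
by rewrite lee_fin H.
Qed.

Lemma le_crit n K th : ThetaK K th ->
  ((\sum_(i < n) ln (p th (w i)) - pen n K)%:E <= crit ThetaK p pen w n K)%E.
Proof.
by move=> Kth; rewrite /crit EFinB leeB// ereal_sup_ubound//; exists th.
Qed.

End Criterion.

(** * Deterministic comparison of orders along one sequence that satisfies the uniform bound *)

Section OrderSelection.
Context (R : realType) (Z : ptopologicalType).
Local Notation ZB := (Borel Z).
Context (Theta : metricType R) (ThetaK : nat -> set Theta).
Variables (p : Theta -> ZB -> R) (pstar : ZB -> R) (pen : nat -> nat -> R).
Hypothesis pen_gt0 : forall n K, (1 <= K)%N -> 0 < pen n K.
Hypothesis pen_mono : forall n K, (1 <= K)%N -> pen n K <= pen n K.+1.
Let r n : R := Num.sqrt (n%:R * ln (ln n%:R)).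
Hypothesis pen_n : forall K, (1 <= K)%N -> (fun n => pen n K / n%:R) @ \oo --> (0 : R).
Hypothesis pen_r : forall K, (1 <= K)%N ->
  limn_esup (fun n => (r n / pen n K)%:E) = 0%E.
Hypothesis pen_inc : forall K, (1 <= K)%N ->
  (1 < limn_einf (fun n => (pen n K.+1 / pen n K)%:E))%E.
Variables (E : Theta -> R) (K0 : nat) (C : R) (w : Seq Z) (N0 : nat).
Hypothesis C0 : 0 <= C.
Hypothesis nested : forall K K', (K <= K')%N -> ThetaK K `<=` ThetaK K'.
Hypothesis lil : forall n, (N0 <= n)%N -> forall th, ThetaK K0 th ->
  `|\sum_(i < n) llr pstar (p th) (w i) - n%:R * E th| <= C * r n.

Let S n := \sum_(i < n) ln (pstar (w i)).

Lemma sum_llrE n th : \sum_(i < n) ln (p th (w i)) =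
  S n + \sum_(i < n) llr pstar (p th) (w i).
Proof. by rewrite /S /llr -big_split /=; apply: eq_bigr => i _; rewrite addrC subrK. Qed.

Lemma loglik_bounds n th : (N0 <= n)%N -> ThetaK K0 th ->
  S n + n%:R * E th - C * r n <= \sum_(i < n) ln (p th (w i)) <= S n + n%:R * E th + C * r n.
Proof.
move=> Nn Kth; have := lil Nn Kth; rewrite sum_llrE ler_distl => /andP[? ?].
by apply/andP; split; lra.
Qed.

Lemma pen_leq K K' n : (1 <= K)%N -> (K <= K')%N -> pen n K <= pen n K'.
Proof.
move=> K1; elim: K' => [|K' IH]; first by case: K K1.
rewrite leq_eqVlt => /predU1P[->//|]; rewrite ltnS => KK'.
by rewrite (le_trans (IH KK'))// pen_mono// (leq_trans K1).
Qed.

(** The likelihood gap [n * eta] beats the fluctuation [2 * C * r n] and the penalty [pen n k'],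
    each eventually at most [n * eta / 4]. *)
Lemma no_underestimation k k' th1 eta : (1 <= k)%N -> (1 <= k')%N ->
  (k <= K0)%N -> (k' <= K0)%N -> ThetaK k' th1 -> 0 < eta ->
  (forall th, ThetaK k th -> E th + eta <= E th1) ->
  exists N, forall n, (N <= n)%N ->
    (crit ThetaK p pen w n k < crit ThetaK p pen w n k')%E.
Proof.
move=> k1 k1' kK k'K K1 eta0 gap.
have C1 : 0 < 2 * C + 1 by rewrite ltr_wpDl// mulr_ge0.
have D0 : 0 < (2 * C + 1)^-1 by rewrite invr_gt0.
have r0 n : 0 <= r n by exact: sqrtr_ge0.
have [N1 HN1] := pen_dominates pen_gt0 k1' r0 (pen_r k1') D0.
have e4 : 0 < eta / 4 by lra.
have [N2 HN2] := pen_small k1' (pen_n k1') e4.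
exists (maxn (maxn N0 1) (maxn N1 N2)) => n; rewrite !geq_max.
move=> /andP[/andP[Nn n0] /andP[Nn1 Nn2]].
have n0R : 0 < n%:R :> R by rewrite ltr0n.
have Hr : 2 * C * r n <= pen n k'.
  have := HN1 n Nn1; rewrite -ler_pdivrMl ?invr_gt0//.
  by rewrite invrK mulrDl mul1r; have := r0 n; lra.
have Hp := HN2 n Nn2 n0.
apply: (@le_lt_trans _ _ (S n + n%:R * (E th1 - eta) + C * r n - pen n k)%:E).
  apply: crit_le.
  move=> th kth; have /andP[_] := loglik_bounds Nn (nested kK kth).
  move=> /le_trans; apply; rewrite lerD2r lerD2l ler_wpM2l// ?(ltW n0R)//.
  by have := gap th kth; lra.
apply: lt_le_trans (le_crit p pen w n K1).
rewrite lte_fin; have /andP[+ _] := loglik_bounds Nn (nested k'K K1).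
have := pen_gt0 n k1; nra.
Qed.

(** A larger model gains at most [2 * C * r n] in likelihood, while its penalty exceeds [pen n Ks]
    by at least [eps * pen n Ks], which is eventually larger. *)
Lemma no_overestimation Ks K th0 : (1 <= Ks)%N -> (Ks < K)%N -> (K <= K0)%N ->
  ThetaK Ks th0 -> 0 <= E th0 -> (forall th, ThetaK K th -> E th <= 0) ->
  exists N, forall n, (N <= n)%N ->
    (crit ThetaK p pen w n K <= crit ThetaK p pen w n Ks)%E.
Proof.
move=> Ks1 KsK KK0 Kth0 E0 Ele0.
have [eps eps0 [N1 HN1]] := pen_ratio pen_gt0 Ks1 (pen_inc Ks1).
have r0 n : 0 <= r n by exact: sqrtr_ge0.
have C1 : 0 < 2 * C + 1 by rewrite ltr_wpDl// mulr_ge0.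
have D0 : 0 < eps / (2 * C + 1) by rewrite divr_gt0.
have [N2 HN2] := pen_dominates pen_gt0 Ks1 r0 (pen_r Ks1) D0.
exists (maxn N0 (maxn N1 N2)) => n; rewrite !geq_max.
move=> /andP[Nn /andP[Nn1 Nn2]].
have Hr : 2 * C * r n <= eps * pen n Ks.
  have := HN2 n Nn2; rewrite mulrAC ler_pdivlMr//.
  by have := r0 n; nra.
have H1 := HN1 n Nn1.
have H2 : pen n Ks.+1 <= pen n K by apply: pen_leq.
apply: (@le_trans _ _ (S n + C * r n - pen n K)%:E).
  apply: crit_le.
  move=> th Kth; have /andP[_] := loglik_bounds Nn (nested KK0 Kth).
  move=> /le_trans; apply; rewrite lerD2r gerDl.
  by rewrite mulr_ge0_le0// Ele0.
apply: le_trans (le_crit p pen w n Kth0).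
have KsK0 : (Ks <= K0)%N by rewrite (leq_trans (ltnW KsK)).
rewrite lee_fin; have /andP[+ _] := loglik_bounds Nn (nested KsK0 Kth0).
have : 0 <= n%:R * E th0 by rewrite mulr_ge0.
by lra.
Qed.

End OrderSelection.

(** * Assembly: consistency of both order estimators *)

Lemma eventually_all (Q : nat -> nat -> Prop) (B : nat) :
  (forall k, (k < B)%N -> exists N, forall n, (N <= n)%N -> Q k n) ->
  exists N, forall n, (N <= n)%N -> forall k, (k < B)%N -> Q k n.
Proof.
elim: B => [|B IH] H; first by exists 0%N.
have [N1 HN1] := IH (fun k kB => H k (ltnW kB)).
have [N2 HN2] := H B (ltnSn B).
exists (maxn N1 N2) => n; rewrite geq_max => /andP[n1 n2] k.
rewrite ltnS leq_eqVlt => /predU1P[->|kB]; first exact: HN2.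
exact: HN1.
Qed.

Theorem theorem3
  (R : realType) (Z : ptopologicalType)
  (mu : {measure set (Borel Z) -> \bar R})
  (Theta : metricType R) (ThetaK : nat -> set Theta)
  (p : Theta -> Borel Z -> R) (pstar : Borel Z -> R)
  (P : probability (Seq Z) R)
  (l u : Borel Z -> R) (pen : nat -> nat -> R) (Kstar : nat) :
  (* setting *)
  polish R Z ->
  sigma_finite setT mu ->
  is_density mu pstar ->
  iid_law mu pstar P ->
  ThetaK 0 = set0 ->
  (forall K, ThetaK K `<=` ThetaK K.+1) ->
  (forall K th, ThetaK K th -> is_density mu (p th)) ->
  (* (A1) *)
  (forall K, (1 <= K)%N -> compact (ThetaK K)) ->
  (forall K, (1 <= K)%N -> weak_compact mu (p @` ThetaK K)) ->
  (* (A2) *)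
  (forall K z, (1 <= K)%N -> {within ThetaK K, continuous (fun th => ln (p th z))}) ->
  (* (A3) *)
  L1_dens mu pstar (fun z => u z - l z) ->
  (forall z, 0 < pstar z /\ l z <= ln (pstar z) <= u z) ->
  (forall K th z, ThetaK K th -> 0 < p th z /\ l z <= ln (p th z) <= u z) ->
  (* (A4) *)
  (forall n K, (1 <= K)%N -> 0 < pen n K) ->
  (forall n K, (1 <= K)%N -> pen n K <= pen n K.+1) ->
  (forall K, (1 <= K)%N -> (fun n => pen n K) @ \oo --> +oo) ->
  (forall K, (1 <= K)%N -> (fun n => pen n K / n%:R) @ \oo --> 0) ->
  (* P* in Pi_{K*} \ Pi_{K*-1}, K* finite *)
  (exists2 th, ThetaK Kstar th & same_law mu pstar (p th)) ->
  ~ (exists2 th, ThetaK Kstar.-1 th & same_law mu pstar (p th)) ->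
  (* integrability of phi(u - l) *)
  L1_dens mu pstar (fun z => phiLL (u z - l z)) ->
  (* penalty conditions *)
  (forall K, (1 <= K)%N ->
     (1 < limn_einf (fun n => (pen n K.+1 / pen n K)%:E))%E) ->
  (forall K, (1 <= K)%N ->
     limn_esup (fun n => (Num.sqrt (n%:R * ln (ln n%:R)) / pen n K)%:E) = 0%E) ->
  (* (a) *)
  ((forall K, (1 <= K)%N ->
      ~ (exists2 th, ThetaK K th & same_law mu pstar (p th)) ->
      (KLset mu pstar (p @` ThetaK K.+1) < KLset mu pstar (p @` ThetaK K))%E) ->
   donsker mu [set (fun z => ln (p th z) - ln (pstar z)) | th in ThetaK Kstar.+1]
           pstar P ->
   {ae P, forall w, exists N, forall n, (N <= n)%N ->
        is_KhatL (crit ThetaK p pen w n) Kstar})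
  /\
  (* (b) *)
  (forall Kmax : nat, (Kstar <= Kmax)%N ->
   donsker mu [set (fun z => ln (p th z) - ln (pstar z)) | th in ThetaK Kmax]
           pstar P ->
   {ae P, forall w, exists N, forall n, (N <= n)%N ->
        is_KhatG (crit ThetaK p pen w n) Kmax Kstar}).
Proof.
move=> _ _ dens iidP Th0 nest densK cpt _ cont iul star_ul model_ul.
move=> pen_gt0 pen_mono _ pen_n [th0 Kth0 sl0] nslK iphi pen_inc pen_r.
have nested K K' : (K <= K')%N -> ThetaK K `<=` ThetaK K'.
  elim: K' => [|K' IH]; first by rewrite leqn0 => /eqP ->.
  rewrite leq_eqVlt => /predU1P[->//|]; rewrite ltnS => /IH H th /H.
  exact: nest.
have Ks1 : (1 <= Kstar)%N.
  by case: Kstar Kth0 {nslK} => //; rewrite Th0.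
have adm K th : ThetaK K th -> admissible mu l u (p th).
  by move=> Kth; split; [exact: densK Kth|move=> z; exact: model_ul Kth].
pose E := Ellr mu p pstar.
have E0 : E th0 = 0 by exact: (same_law_Edens_llr dens (adm _ _ Kth0) sl0).
have E0ge : 0 <= E th0 by rewrite E0.
have Ele0 K th : ThetaK K th -> E th <= 0.
  by move=> Kth; exact: (Edens_llr_le0 dens iul star_ul (adm _ _ Kth)).
have KLE K th : ThetaK K th -> KL mu pstar (p th) = (- E th)%:E.
  by move=> Kth; exact: (KL_llr dens iul star_ul (adm _ _ Kth)).
have nsl k : (k < Kstar)%N -> ~ (exists2 th, ThetaK k th & same_law mu pstar (p th)).
  move=> kK [th kth slth]; apply: nslK; exists th => //.
  by apply: nested kth; rewrite -ltnS prednK.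
have goodC K : (Kstar <= K)%N ->
    donsker mu [set (fun z => ln (p th z) - ln (pstar z)) | th in ThetaK K] pstar P ->
    exists2 C : R, 0 <= C & {ae P, forall w : Seq Z, exists N, forall n, (N <= n)%N ->
      forall th, ThetaK K th ->
      `|\sum_(i < n) llr pstar (p th) (w i) - n%:R * E th| <=
        C * Num.sqrt (n%:R * ln (ln n%:R))}.
  move=> KsK don; have K1 := leq_trans Ks1 KsK.
  apply: (uniform_lil iidP dens iul star_ul (adm K) (cpt K K1) (fun z => cont K z K1)) => //.
  by exists th0; exact: nested Kth0.
split => [HKL don|Kmax KsKmax don].
  have [C C0 aeC] := goodC _ (leqnSn Kstar) don.
  apply: filterS aeC => w [N0 lil].
  have [N1 HN1] : exists N, forall n, (N <= n)%N -> forall k, (k < Kstar)%N ->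
      (1 <= k)%N -> (crit ThetaK p pen w n k < crit ThetaK p pen w n k.+1)%E.
    apply: eventually_all => k kK.
    have [->|k0] := posnP k; first by exists 0%N.
    (* Strict decrease of the divergence yields a parameter of order [k.+1] that is better than the
       whole model of order [k]. *)
    have /ereal_inf_lt[_ [_ [th1 kth1 <-] <-]] := HKL k k0 (nsl k kK).
    rewrite (KLE _ _ kth1) => Hth1.
    have [eta eta0 Heta] : exists2 eta, 0 < eta &
        forall th, ThetaK k th -> E th + eta <= E th1.
      have le_KL th : ThetaK k th -> (KLset mu pstar (p @` ThetaK k) <= (- E th)%:E)%E.
        move=> kth; rewrite -(KLE _ _ kth).
        by apply: ereal_inf_lbound; exists (p th) => //; exists th.
      (* A finite infimum [r] leaves the gap [r + E th1]. The value [+oo] would force [ThetaK k] to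
         be empty, as all divergences are finite, and then any [eta] works. *)
      case: (KLset _ _ _) Hth1 le_KL => [r| |] Hth1 le_KL; last by [].
        exists (r + E th1); first by rewrite lte_fin in Hth1; lra.
        by move=> th /le_KL; rewrite lee_fin; lra.
      by exists 1 => // th /le_KL.
    have kKs : (k.+1 <= Kstar.+1)%N by rewrite ltnS ltnW.
    have [N HN] := no_underestimation pen_gt0 pen_n pen_r C0 nested lil k0 (ltn0Sn k)
      (ltnW kKs) kKs kth1 eta0 Heta.
    by exists N => n Nn _; exact: HN.
  have [N2 HN2] := no_overestimation pen_gt0 pen_mono pen_r pen_inc C0 nested lil Ks1
    (ltnSn Kstar) (leqnn _) Kth0 E0ge (fun th Kth => Ele0 _ th Kth).
  exists (maxn N1 N2) => n; rewrite geq_max => /andP[n1 n2]; split => //.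
    exact: HN2.
  by move=> k /andP[k1 kK]; exact: HN1.
have [C C0 aeC] := goodC _ KsKmax don.
apply: filterS aeC => w [N0 lil].
have [N1 HN1] : exists N, forall n, (N <= n)%N -> forall k, (k < Kstar)%N ->
    (1 <= k)%N -> (crit ThetaK p pen w n k < crit ThetaK p pen w n Kstar)%E.
  apply: eventually_all => k kK.
  have [->|k0] := posnP k; first by exists 0%N.
  (* In (b) order [k] is compared with [Kstar] directly, so the gap comes from compactness and not
     from strict decrease. *)
  have [eta eta0 Heta] := Ellr_gap dens iul star_ul (adm k) (cpt k k0)
    (fun z => cont k z k0) (nsl k kK).
  have Heta' th : ThetaK k th -> E th + eta <= E th0 by rewrite E0; exact: Heta.
  have [N HN] := no_underestimation pen_gt0 pen_n pen_r C0 nested lil k0 Ks1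
    (leq_trans (ltnW kK) KsKmax) KsKmax Kth0 eta0 Heta'.
  by exists N => n Nn _; exact: HN.
have [N2 HN2] : exists N, forall n, (N <= n)%N -> forall k, (k < Kmax.+1)%N ->
    (Kstar < k)%N -> (crit ThetaK p pen w n k <= crit ThetaK p pen w n Kstar)%E.
  apply: eventually_all => k kK.
  have [kKs|Ksk] := leqP k Kstar; first by exists 0%N.
  have [N HN] := no_overestimation pen_gt0 pen_mono pen_r pen_inc C0 nested lil Ks1
    Ksk kK Kth0 E0ge (fun th Kth => Ele0 _ th Kth).
  by exists N => n Nn _; exact: HN.
exists (maxn N1 N2) => n; rewrite geq_max => /andP[n1 n2]; split.
- by rewrite Ks1.
(* Ties with larger orders are harmless, since the smallest maximizer is selected; below [Kstar] the
   inequality is strict. *)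
- move=> k /andP[k1 kK]; have [kKs|Ksk|->//] := ltngtP k Kstar.
    by apply: ltW; exact: HN1.
  exact: HN2.
- by move=> k /andP[k1 kK]; exact: HN1.
Qed.
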